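(* Let $\theta(q,x)=\sum_{j=0}^{\infty}q^{j(j+1)/2}x^j$ for $|q|<1$, and set $\theta(-1,x):=(1-x)/(1+x^2)$ for $x\in[-3.1,3.2]$. (1) For $q\in(-1,0)$, any negative zero of $\theta(q,\cdot)$ is $<-2.4$. (2) For $q\in(-1,0)$, any positive zero of $\theta(q,\cdot)$, except the smallest one, is $>2.4$. (3) $\theta$ has no negative zero for $(q,x)\in\tilde Q_-:=[-1,-0.75]\times[-3.1,0]$. For $(q,x)\in\tilde Q_+:=[-1,-0.8]\times[0,3.2]$, its only positive zero is the smallest one (i.e. for each $q\in[-1,-0.8]$ the only zero of $\theta(q,\cdot)$ in $[0,3.2]$ is its smallest positive zero). One has $\theta(q,x)>0.0049$ for $(q,x)\in\partial\tilde Q_-$, and $\theta(q,3.2)<-0.015$ for $q\in[-1,-0.78]$. The three smallest positive zeros of $\theta(-0.78,\cdot)$ are $<3.2$.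
   Context: The partial theta function is $\theta(q,x):=\sum_{j=0}^{\infty}q^{j(j+1)/2}x^j$; for each fixed $q$ with $|q|<1$ it is an entire function of $x$. The value $q=-1$ is allowed by the convention $\theta(-1,x)=(1-x)/(1+x^2)$, which is the limit of $\theta(q,x)$ as $q\to-1^+$, uniform on compact subsets of the interior of the closed curve obtained by setting $-x^2=e^{t\pm it}$, $t\in[0,\pi]$ (this interior contains the segment $[-3.1,3.2]$). $\partial\tilde Q_-$ is the boundary of the rectangle $\tilde Q_-\subset\mathbb{R}^2$. *)

(* Defs.v *)
From Stdlib Require Import Reals Lra Lia Psatz Arith.
From Coquelicot Require Import Coquelicot.
Open Scope R_scope.

(** The partial theta function of real arguments.  It is meaningful for [|q| < 1] and all real [x]
    (the series then converges), and for [q = -1] with [-3.1 <= x <= 3.2], where it is given by the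
    limit as [q] tends to [-1] from the right.  Other values are irrelevant; at [q = -1] the closed
    form is kept for every [x], which adds no zeros (its only real zero is [1]). *)
Definition theta (q x : R) : R :=
  if Req_EM_T q (-1) then (1 - x) / (1 + x ^ 2)
  else Series (fun j : nat => q ^ (j * (j + 1) / 2)%nat * x ^ j).

Definition is_smallest_positive_zero (f : R -> R) (x : R) : Prop :=
  0 < x /\ f x = 0 /\ forall y : R, 0 < y -> f y = 0 -> x <= y.

(** Zeros are distinct points, not counted with multiplicity. *)
Definition three_smallest_positive_zeros (f : R -> R) (x1 x2 x3 : R) : Prop :=
  0 < x1 < x2 /\ x2 < x3 /\ f x1 = 0 /\ f x2 = 0 /\ f x3 = 0 /\
  forall y : R, 0 < y <= x3 -> f y = 0 -> y = x1 \/ y = x2 \/ y = x3.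

(** Topological boundary: closure minus interior. *)
Definition boundary {T : UniformSpace} (A : T -> Prop) (p : T) : Prop :=
  ~ locally p (fun z => ~ A z) /\ ~ locally p A.

Definition Qminus (p : R * R) : Prop :=
  -1 <= fst p <= -0.75 /\ -3.1 <= snd p <= 0.

Definition Qplus (p : R * R) : Prop :=
  -1 <= fst p <= -0.8 /\ 0 <= snd p <= 3.2.

(* Main.v *)
Require Import Defs.
From Stdlib Require Import Reals Lra Lia Psatz ZArith Arith ClassicalEpsilon.
From Coquelicot Require Import Coquelicot.
Open Scope R_scope.

(** Put [q = -p]. In the variables [ln p] and [ln x] each term of [theta] solves one constant
    coefficient heat equation in which [p] increasing is the forward time direction, so
    bounds for [theta] and for [x d/dx theta] on a rectangle follow from bounds at the smallest [p]
    and on the two sides [x = const]. The zeros are thereby confined: [theta (q, -x) > 0] on the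
    stated ranges, while for positive [x] either [theta] decreases or it is negative. What remains
    are one-variable inequalities. For [p <= 0.905] they are checked by interval arithmetic. For
    [p] close to [1], [theta (q, x) = Theta (q, x) - theta (q, 1/x) / x], where [Theta] is the
    bilateral theta series; the second term is harmless, and [Theta] and its derivative
    are exponentially small: after a change of variables they form an antiperiodic solution of the
    heat equation that vanishes at the ends of a period (or half a period away from them), and
    the minimum principle compares it with an exponentially decaying cosine. *)

(** * Series and their partial sums *)

(** For fixed [x > 1] the largest term of the series grows like [exp (T s^2 / 2)], where [s = ln x]
    and [p = exp (- 1/T)], while the sum stays bounded. Close to [p = 1] interval arithmetic
    therefore loses all precision, and no fixed number of terms suffices. The cut [0.905] lies just
    above [exp (- 1/10)], so that [T >= 10] beyond it. There the growth [exp (T s^2 / 2)] competes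
    with the decay [exp (- (961/800) T)], where [961/800] is half the square of [31/20]; the latter
    wins for every [x] that occurs, the largest being [3.1 / 0.905 < 3.43]. At [1/x < 1] the series
    converges geometrically up to [p = 1], and a fixed number of terms is enough. For [p] close to
    [1] a negative argument is first moved to a positive one by the functional equation. Both uses
    of the minimum principle concern finite sums, which solve their equations exactly; the limit is
    taken afterwards, with errors that are uniform on the rectangle. *)

Definition tri (j : nat) : nat := (j * (j + 1) / 2)%nat.
Arguments tri : simpl never.

Lemma tri_S (j : nat) : tri (S j) = (tri j + S j)%nat.
Proof.
  unfold tri.
  replace (S j * (S j + 1))%nat with (j * (j + 1) + S j * 2)%nat by ring.
  now rewrite Nat.div_add.
Qed.

Lemma INR_tri (j : nat) : 2 * INR (tri j) = INR j * INR j + INR j.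
Proof.
  induction j as [|j IH]; [simpl; ring|].
  rewrite tri_S, plus_INR, S_INR. nra.
Qed.

(** A weight receives the index [j] and the exponent [tri j] of its term; integer values keep
    the partial sums computable. *)
Definition weight := Z -> Z -> Z.

Definition wt (w : weight) (j : nat) : R := IZR (w (Z.of_nat j) (Z.of_nat (tri j))).

Definition mono (p x : R) (j : nat) : R := p ^ tri j * x ^ j.
Arguments mono : simpl never.

Fixpoint psum (w : weight) (n : nat) (p x : R) : R :=
  match n with
  | O => 0
  | S m => psum w m p x + wt w m * mono p x m
  end.

(** The bound admits the signs and their multiples by [j] and [j + 1], so one tail estimate serves
    theta and its derivative. Weights such as [tw w] grow faster and occur in finite sums only. *)
Definition tame (w : weight) : Prop := forall j, Rabs (wt w j) <= INR j + 1.

Lemma mono_S (p x : R) (j : nat) : mono p x (S j) = mono p x j * (p ^ S j * x).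
Proof. unfold mono. rewrite tri_S, pow_add. simpl. ring. Qed.

Lemma mono_pos (p x : R) (j : nat) : 0 <= p -> 0 <= x -> 0 <= mono p x j.
Proof. intros. apply Rmult_le_pos; now apply pow_le. Qed.

Lemma mono_incr (p x P X : R) (j : nat) :
  0 <= p <= P -> 0 <= x <= X -> mono p x j <= mono P X j.
Proof.
  intros. apply Rmult_le_compat; try (apply pow_le; lra); apply pow_incr; lra.
Qed.

Lemma pow_decr_le1 (p : R) (m n : nat) : 0 <= p <= 1 -> (m <= n)%nat -> p ^ n <= p ^ m.
Proof.
  intros Hp H. replace n with (m + (n - m))%nat by lia. rewrite pow_add.
  assert (0 <= p ^ m) by (apply pow_le; lra).
  assert (p ^ (n - m) <= 1) by (rewrite <- (pow1 (n - m)); apply pow_incr; lra).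
  nra.
Qed.

(** The ratio of consecutive majorants is [(j + 2) / (j + 1) * p ^ (j + 1) * x]. Both
    [(j + 2) / (j + 1)] and the power decrease in [j], so a test at [N] gives the factor [3/4] from
    there on. The integer form of the test is the one that [piece] evaluates. *)
Lemma majorant_ratio (N j : nat) (p x : R) :
  0 <= p <= 1 -> 0 <= x -> 4 * (INR N + 2) * (p ^ N * x) <= 3 * (INR N + 1) -> (N <= j)%nat ->
  4 * ((INR (S j) + 1) * mono p x (S j)) <= 3 * ((INR j + 1) * mono p x j).
Proof.
  intros Hp Hx HN Hj.
  rewrite mono_S, S_INR.
  assert (H0 := mono_pos p x j (proj1 Hp) Hx).
  assert (Hl : p ^ S j * x <= p ^ N * x)
    by (apply Rmult_le_compat_r; [lra | apply pow_decr_le1; lia || lra]).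
  assert (HNj : INR N <= INR j) by now apply le_INR.
  assert (0 <= INR N) by apply pos_INR.
  assert (0 <= p ^ S j * x) by (apply Rmult_le_pos; [apply pow_le|]; lra).
  set (y := p ^ S j * x) in *. set (z := p ^ N * x) in *.
  assert (Hy : 4 * (INR j + 2) * y <= 3 * (INR j + 1)).
  { assert (4 * (INR N + 2) * y <= 3 * (INR N + 1)) by nra.
    assert (4 * y <= 3) by nra. nra. }
  replace (4 * ((INR j + 1 + 1) * (mono p x j * y)))
    with (mono p x j * (4 * (INR j + 2) * y)) by ring.
  replace (3 * ((INR j + 1) * mono p x j)) with (mono p x j * (3 * (INR j + 1))) by ring.
  now apply Rmult_le_compat_l.
Qed.

Lemma psum_tail (w : weight) (N n : nat) (p x : R) :
  tame w -> 0 <= p <= 1 -> 0 <= x ->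
  4 * (INR N + 2) * (p ^ N * x) <= 3 * (INR N + 1) -> (N <= n)%nat ->
  Rabs (psum w n p x - psum w N p x) <= 4 * ((INR N + 1) * mono p x N).
Proof.
  intros Hw Hp Hx HN Hn.
  (* The induction telescopes: a new term is at most the current majorant, and four times the
     majorant drops by at least that much. *)
  enough (Rabs (psum w n p x - psum w N p x)
          <= 4 * ((INR N + 1) * mono p x N) - 4 * ((INR n + 1) * mono p x n)).
  { assert (0 <= mono p x n) by (apply mono_pos; lra).
    assert (0 <= INR n) by apply pos_INR. nra. }
  induction Hn as [|n Hn IH].
  - rewrite Rminus_diag. rewrite Rabs_R0. lra.
  - assert (Hr := majorant_ratio N n p x Hp Hx HN Hn).
    simpl psum.
    replace (psum w n p x + wt w n * mono p x n - psum w N p x)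
      with (psum w n p x - psum w N p x + wt w n * mono p x n) by ring.
    eapply Rle_trans; [apply Rabs_triang|].
    rewrite Rabs_mult, (Rabs_pos_eq (mono p x n)) by (apply mono_pos; lra).
    assert (Rabs (wt w n) * mono p x n <= (INR n + 1) * mono p x n)
      by (apply Rmult_le_compat_r; [apply mono_pos; lra | apply Hw]).
    lra.
Qed.

Lemma psum_unif (P X eps : R) :
  0 <= P < 1 -> 0 <= X -> 0 < eps ->
  exists N, forall w p x n m, tame w -> 0 <= p <= P -> 0 <= x <= X ->
    (N <= n)%nat -> (N <= m)%nat -> Rabs (psum w n p x - psum w m p x) <= eps.
Proof.
  intros HP HX He.
  (* This makes [p ^ N * x] at most [1/4] for [N >= N0]; the ratio condition then follows from
     [N + 2 <= 3 (N + 1)]. *)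
  destruct (pow_lt_1_zero P ltac:(rewrite Rabs_pos_eq; lra) (/ (4 * (X + 1)))
    ltac:(apply Rinv_0_lt_compat; lra)) as [N0 HN0].
  assert (Hcond : forall N p x, (N0 <= N)%nat -> 0 <= p <= P -> 0 <= x <= X ->
    4 * (INR N + 2) * (p ^ N * x) <= 3 * (INR N + 1)).
  { intros N p x HN Hp Hx.
    specialize (HN0 N HN). rewrite Rabs_pos_eq in HN0 by (apply pow_le; lra).
    assert (p ^ N <= P ^ N) by (apply pow_incr; lra).
    assert (0 <= p ^ N) by (apply pow_le; lra).
    assert (p ^ N * x <= / (4 * (X + 1)) * (X + 1)) by (apply Rmult_le_compat; lra).
    replace (/ (4 * (X + 1)) * (X + 1)) with (1/4) in * by (field; lra).
    assert (0 <= INR N) by apply pos_INR. nra. }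
  set (b := fun j => (INR j + 1) * mono P X j).
  assert (Hb : forall k, b (N0 + k)%nat <= (3/4) ^ k * b N0).
  { induction k as [|k IH].
    - rewrite Nat.add_0_r. simpl. lra.
    - rewrite Nat.add_succ_r.
      assert (Hr := majorant_ratio N0 (N0 + k) P X ltac:(lra) HX
        (Hcond N0 P X (le_n _) ltac:(lra) ltac:(lra)) ltac:(lia)).
      fold (b (N0 + k)%nat) in Hr. fold (b (S (N0 + k))) in Hr.
      simpl. lra. }
  assert (Hb0 : 0 <= b N0).
  { unfold b. apply Rmult_le_pos; [assert (0 <= INR N0) by apply pos_INR; lra|].
    apply mono_pos; lra. }
  destruct (pow_lt_1_zero (3/4) ltac:(rewrite Rabs_pos_eq; lra) (eps / (8 * (b N0 + 1)))
    ltac:(apply Rdiv_lt_0_compat; lra)) as [k Hk].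
  specialize (Hk k (le_n _)). rewrite Rabs_pos_eq in Hk by (apply pow_le; lra).
  exists (N0 + k)%nat. intros w p x n m Hw Hp Hx Hn Hm.
  assert (Ht : forall i, (N0 + k <= i)%nat ->
    Rabs (psum w i p x - psum w (N0 + k) p x) <= eps / 2).
  { intros i Hi.
    eapply Rle_trans;
      [apply psum_tail; try lra; [exact Hw | apply Hcond; lia || lra | lia]|].
    assert (mono p x (N0 + k) <= mono P X (N0 + k)) by now apply mono_incr.
    specialize (Hb k). unfold b at 1 in Hb.
    assert (0 <= INR (N0 + k)) by apply pos_INR.
    assert ((3/4)^k * b N0 <= eps / (8 * (b N0 + 1)) * (b N0 + 1)).
    { apply Rmult_le_compat; try lra. apply pow_le; lra. }
    replace (eps / (8 * (b N0 + 1)) * (b N0 + 1)) with (eps / 8) in * by (field; lra).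
    nra. }
  assert (H1 := Ht n Hn). assert (H2 := Ht m Hm).
  apply Rabs_le_between in H1. apply Rabs_le_between in H2. apply Rabs_le. lra.
Qed.

Definition U (w : weight) (p x : R) : R := real (Lim_seq (fun n => psum w n p x)).

Lemma U_lim (w : weight) (p x : R) :
  tame w -> 0 <= p < 1 -> 0 <= x -> is_lim_seq (fun n => psum w n p x) (U w p x).
Proof.
  intros Hw Hp Hx. apply Lim_seq_correct'. apply ex_lim_seq_cauchy_corr.
  intros eps.
  destruct (psum_unif p x (eps / 2) Hp Hx ltac:(destruct eps; simpl; lra)) as [N HN].
  exists N. intros n m Hn Hm.
  eapply Rle_lt_trans; [apply HN; try lra; assumption|]. destruct eps; simpl; lra.
Qed.

Lemma U_ge (w : weight) (p x c : R) (N : nat) :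
  tame w -> 0 <= p < 1 -> 0 <= x ->
  (forall n, (N <= n)%nat -> c <= psum w n p x) -> c <= U w p x.
Proof.
  intros Hw Hp Hx H.
  assert (Hl := U_lim w p x Hw Hp Hx).
  apply (is_lim_seq_le_loc (fun _ => c) (fun n => psum w n p x) c (U w p x));
    [exists N; exact H | apply is_lim_seq_const | exact Hl].
Qed.

Lemma U_unif (P X eps : R) :
  0 <= P < 1 -> 0 <= X -> 0 < eps ->
  exists N, forall w p x n, tame w -> 0 <= p <= P -> 0 <= x <= X ->
    (N <= n)%nat -> Rabs (psum w n p x - U w p x) <= eps.
Proof.
  intros HP HX He. destruct (psum_unif P X eps HP HX He) as [N HN].
  exists N. intros w p x n Hw Hp Hx Hn.
  assert (Hl := U_lim w p x Hw ltac:(lra) ltac:(lra)).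
  assert (Hl2 : is_lim_seq (fun m => Rabs (psum w n p x - psum w m p x))
                  (Rabs (psum w n p x - U w p x))).
  { apply (is_lim_seq_abs _ (Finite (psum w n p x - U w p x))).
    apply is_lim_seq_minus'; [apply is_lim_seq_const | exact Hl]. }
  apply (is_lim_seq_le_loc (fun m => Rabs (psum w n p x - psum w m p x)) (fun _ => eps)
           (Rabs (psum w n p x - U w p x)) eps);
    [exists N; intros m Hm; apply HN; assumption | exact Hl2 | apply is_lim_seq_const].
Qed.

(** With [p = - q >= 0] and [x >= 0], the weights [sp], [sm] and [sn] give [theta q x],
    [theta q (- x)] and [- theta q x]; [jw] and [tw] implement [x d/dx] and [p d/dp]. *)
Definition sp : weight := fun j t => if Z.odd t then (-1)%Z else 1%Z.
Definition sm : weight := fun j t => if Z.odd (t + j) then (-1)%Z else 1%Z.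
Definition sn : weight := fun j t => if Z.odd t then 1%Z else (-1)%Z.
Definition jw (w : weight) : weight := fun j t => (j * w j t)%Z.
Definition j1w (w : weight) : weight := fun j t => ((j + 1) * w j t)%Z.
Definition tw (w : weight) : weight := fun j t => (t * w j t)%Z.

Lemma wt_jw (w : weight) (j : nat) : wt (jw w) j = INR j * wt w j.
Proof. unfold wt, jw. now rewrite mult_IZR, <- INR_IZR_INZ. Qed.

Lemma wt_j1w (w : weight) (j : nat) : wt (j1w w) j = (INR j + 1) * wt w j.
Proof. unfold wt, j1w. now rewrite mult_IZR, plus_IZR, <- INR_IZR_INZ. Qed.

Lemma wt_tw (w : weight) (j : nat) : wt (tw w) j = INR (tri j) * wt w j.
Proof. unfold wt, tw. now rewrite mult_IZR, <- INR_IZR_INZ. Qed.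

Lemma pow_m1 (n : nat) : (-1) ^ n = if Z.odd (Z.of_nat n) then -1 else 1.
Proof.
  induction n as [|n IH]; [reflexivity|].
  rewrite Nat2Z.inj_succ, Z.odd_succ, <- Z.negb_odd. simpl. rewrite IH.
  destruct (Z.odd _); simpl; ring.
Qed.

Lemma wt_sp (j : nat) : wt sp j = (-1) ^ tri j.
Proof. unfold wt, sp. rewrite pow_m1. now destruct (Z.odd _). Qed.

Lemma wt_sm (j : nat) : wt sm j = (-1) ^ (tri j + j).
Proof. unfold wt, sm. rewrite pow_m1, Nat2Z.inj_add. now destruct (Z.odd _). Qed.

Lemma wt_sn (j : nat) : wt sn j = - wt sp j.
Proof. unfold wt, sn, sp. destruct (Z.odd _); simpl; lra. Qed.

Definition unimodular (w : weight) : Prop := forall j, Rabs (wt w j) = 1.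

Lemma unimodular_sp : unimodular sp.
Proof. intros j. rewrite wt_sp. apply pow_1_abs. Qed.
Lemma unimodular_sm : unimodular sm.
Proof. intros j. rewrite wt_sm. apply pow_1_abs. Qed.
Lemma unimodular_sn : unimodular sn.
Proof. intros j. rewrite wt_sn, Rabs_Ropp. apply unimodular_sp. Qed.

Lemma tame_unimodular (w : weight) : unimodular w -> tame w.
Proof. intros H j. rewrite H. assert (0 <= INR j) by apply pos_INR. lra. Qed.
Lemma tame_jw (w : weight) : unimodular w -> tame (jw w).
Proof.
  intros H j. assert (0 <= INR j) by apply pos_INR.
  rewrite wt_jw, Rabs_mult, H, Rabs_pos_eq; lra.
Qed.
Lemma tame_j1w (w : weight) : unimodular w -> tame (j1w w).
Proof.
  intros H j. assert (0 <= INR j) by apply pos_INR.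
  rewrite wt_j1w, Rabs_mult, H, Rabs_pos_eq; lra.
Qed.

Lemma theta_U (w : weight) (s p x : R) :
  0 <= p < 1 -> 0 <= x -> tame w ->
  (forall j, wt w j = (-1) ^ tri j * s ^ j) -> theta (- p) (s * x) = U w p x.
Proof.
  intros Hp Hx Hw Hs. unfold theta.
  destruct (Req_EM_T (- p) (-1)) as [E|_]; [lra|].
  (* [Series] unfolds to the same [real (Lim_seq _)]; its [sum_n] includes the last index, hence the
     shift by one. *)
  unfold Series, U. f_equal.
  rewrite <- (Lim_seq_incr_1 (fun n => psum w n p x)).
  apply Lim_seq_ext. intros n. induction n as [|n IH].
  - rewrite sum_O. simpl psum. unfold mono. rewrite Hs.
    change (0 * (0 + 1) / 2)%nat with 0%nat. change (tri 0) with 0%nat. simpl. ring.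
  - rewrite sum_Sn, IH.
    change (psum w (S (S n)) p x) with (psum w (S n) p x + wt w (S n) * mono p x (S n)).
    change (psum w (S n) p x + (- p) ^ tri (S n) * (s * x) ^ S n
            = psum w (S n) p x + wt w (S n) * mono p x (S n)).
    unfold mono. rewrite Hs.
    replace (- p) with (-1 * p) by ring. rewrite !Rpow_mult_distr. ring.
Qed.

Lemma theta_pos (p x : R) : 0 <= p < 1 -> 0 <= x -> theta (- p) x = U sp p x.
Proof.
  intros. rewrite <- (Rmult_1_l x) at 1. apply theta_U; try assumption.
  - apply tame_unimodular, unimodular_sp.
  - intros. now rewrite wt_sp, pow1, Rmult_1_r.
Qed.

Lemma theta_neg (p x : R) : 0 <= p < 1 -> 0 <= x -> theta (- p) (- x) = U sm p x.
Proof.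
  intros. replace (- x) with (-1 * x) by ring. apply theta_U; try assumption.
  - apply tame_unimodular, unimodular_sm.
  - intros. now rewrite wt_sm, pow_add.
Qed.

Lemma psum_opp (w v : weight) (n : nat) (p x : R) :
  (forall j, wt v j = - wt w j) -> psum v n p x = - psum w n p x.
Proof. intros H. induction n; simpl; [ring|]. rewrite IHn, H. ring. Qed.

Lemma U_opp (w v : weight) (p x : R) : (forall j, wt v j = - wt w j) -> U v p x = - U w p x.
Proof.
  intros Hv. unfold U. rewrite (Lim_seq_ext _ (fun n => - psum w n p x)).
  - rewrite Lim_seq_opp. destruct (Lim_seq _); simpl; ring.
  - intros n. now apply psum_opp.
Qed.

Lemma U_sn (p x : R) : U sn p x = - U sp p x.
Proof. apply U_opp, wt_sn. Qed.

(** * The minimum principle *)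

Lemma exp_le (x y : R) : x <= y -> exp x <= exp y.
Proof. intros [H|<-]; [left; now apply exp_increasing | right; reflexivity]. Qed.

(** The gauge at a point is a radius within which [f] stays above half its value there, and is
    itself at most that half. The positive lower bound that compactness gives for the gauge is then
    one for [f]. *)
Lemma rect_pos_lb (f : R -> R -> R) (a b c d : R) :
  (forall x y, a <= x <= b -> c <= y <= d -> continuity_2d_pt f x y /\ 0 < f x y) ->
  exists m, 0 < m /\ forall x y, a <= x <= b -> c <= y <= d -> m <= f x y.
Proof.
  intros H.
  assert (Hd : forall x y, exists e : posreal, a <= x <= b -> c <= y <= d ->
    e <= f x y / 2 /\
    forall u v, Rabs (u - x) < e -> Rabs (v - y) < e -> f x y / 2 < f u v).
  { intros x y.
    destruct (classic (a <= x <= b /\ c <= y <= d)) as [[Hx Hy]|N];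
      [|exists (mkposreal 1 Rlt_0_1); tauto].
    destruct (H x y Hx Hy) as [Hc Hp].
    destruct (Hc (mkposreal (f x y / 2) ltac:(lra))) as [e He]. simpl in He.
    assert (Hm : 0 < Rmin e (f x y / 2)) by (apply Rmin_pos; [apply cond_pos | lra]).
    exists (mkposreal _ Hm). intros _ _. simpl. split; [apply Rmin_r|].
    intros u v Hu Hv.
    assert (Hr := Rmin_l e (f x y / 2)).
    specialize (He u v ltac:(lra) ltac:(lra)). apply Rabs_lt_between in He. lra. }
  set (delta := fun x y => proj1_sig (constructive_indefinite_description _ (Hd x y))).
  assert (Hdelta := fun x y =>
    proj2_sig (constructive_indefinite_description _ (Hd x y))).
  fold delta in Hdelta.
  destruct (compactness_value_2d a b c d delta) as [m Hm].
  exists m. split; [apply cond_pos|].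
  intros x y Hx Hy. apply Rnot_lt_le. intros Hlt.
  apply (Hm x y Hx Hy). intros (u & v & Hu & Hv & Hxu & Hyv & Hle).
  destruct (Hdelta u v Hu Hv) as [H1 H2].
  change (proj1_sig (constructive_indefinite_description _ (Hd u v))) with (delta u v) in *.
  specialize (H2 x y Hxu Hyv). lra.
Qed.

(** Passing to [exp f] makes the function positive, so its infimum [- s] exists. If it were not
    attained, [exp f + s] would be positive everywhere and hence bounded away from [0],
    contradicting the choice of [s]. *)
Lemma rect_min (f : R -> R -> R) (a b c d : R) :
  a <= b -> c <= d ->
  (forall x y, a <= x <= b -> c <= y <= d -> continuity_2d_pt f x y) ->
  exists x0 y0, a <= x0 <= b /\ c <= y0 <= d /\
    forall x y, a <= x <= b -> c <= y <= d -> f x0 y0 <= f x y.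
Proof.
  intros Hab Hcd Hc.
  set (g := fun x y => exp (f x y)).
  assert (Hg : forall x y, a <= x <= b -> c <= y <= d -> continuity_2d_pt g x y).
  { intros x y Hx Hy. apply (continuity_1d_2d_pt_comp exp f); [|now apply Hc].
    apply derivable_continuous_pt, derivable_pt_exp. }
  destruct (rect_pos_lb g a b c d) as (m & Hm & Hmin).
  { intros x y Hx Hy. split; [now apply Hg | apply exp_pos]. }
  set (E := fun z => exists x y, a <= x <= b /\ c <= y <= d /\ z = - g x y).
  destruct (completeness E) as [s [Hs1 Hs2]].
  { exists (- m). intros z (x & y & Hx & Hy & ->). specialize (Hmin x y Hx Hy). lra. }
  { exists (- g a c). exists a, c. repeat split; lra. }
  apply NNPP. intros Hno.
  destruct (rect_pos_lb (fun x y => g x y + s) a b c d) as (m' & Hm' & Hmin').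
  { intros x y Hx Hy. split.
    - apply continuity_2d_pt_plus; [now apply Hg | apply continuity_2d_pt_const].
    - assert (- g x y <= s) by (apply Hs1; exists x, y; tauto).
      destruct (Req_dec (g x y + s) 0) as [E0|]; [|lra].
      exfalso. apply Hno. exists x, y. repeat split; try tauto.
      intros u v Hu Hv. apply Rnot_lt_le. intros Hlt.
      assert (- g u v <= s) by (apply Hs1; exists u, v; tauto).
      assert (g u v < g x y) by now apply exp_increasing. lra. }
  assert (s <= s - m'); [|lra].
  apply Hs2. intros z (x & y & Hx & Hy & ->). specialize (Hmin' x y Hx Hy). simpl in Hmin'. lra.
Qed.

Lemma deriv_interior_min (f : R -> R) (x l e : R) :
  is_derive f x l -> 0 < e -> (forall y, Rabs (y - x) < e -> f x <= f y) -> l = 0.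
Proof.
  intros Hd He Hmin.
  apply is_derive_Reals in Hd.
  set (pr := exist _ l Hd : derivable_pt f x).
  change l with (derive_pt f x pr).
  apply (deriv_minimum f (x - e) (x + e) x pr); try lra.
  intros y H1 H2. apply Hmin. apply Rabs_lt_between'. lra.
Qed.

(** One-sided, because the minimum of a heat solution may lie at the final time. *)
Lemma deriv_left_min (f : R -> R) (x l e : R) :
  is_derive f x l -> 0 < e -> (forall y, x - e < y < x -> f x <= f y) -> l <= 0.
Proof.
  intros Hd He Hmin. apply is_derive_Reals in Hd.
  apply Rnot_lt_le. intros Hl.
  destruct (Hd l Hl) as [d Hd'].
  assert (Hm : 0 < Rmin d e) by (apply Rmin_pos; [apply cond_pos | lra]).
  assert (H1 := Rmin_l d e). assert (H2 := Rmin_r d e).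
  set (h := - (Rmin d e / 2)).
  assert (Hh : h < 0) by (unfold h; lra).
  specialize (Hd' h ltac:(lra) ltac:(unfold h; rewrite Rabs_Ropp, Rabs_pos_eq; lra)).
  apply Rabs_lt_between in Hd'.
  assert (f x <= f (x + h)) by (apply Hmin; unfold h; lra).
  assert ((f (x + h) - f x) / h <= 0); [|lra].
  unfold Rdiv. assert (/ h < 0) by now apply Rinv_lt_0_compat. nra.
Qed.

Lemma deriv2_interior_min (f f' : R -> R) (x l e : R) :
  (forall y, Rabs (y - x) < e -> is_derive f y (f' y)) -> is_derive f' x l ->
  0 < e -> (forall y, Rabs (y - x) < e -> f x <= f y) -> 0 <= l.
Proof.
  intros Hf Hf' He Hmin.
  assert (Hx0 : Rabs (x - x) < e) by (rewrite Rminus_diag, Rabs_R0; exact He).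
  assert (H0 : f' x = 0) by (apply (deriv_interior_min f x _ e); auto).
  apply is_derive_Reals in Hf'.
  apply Rnot_lt_le. intros Hl.
  destruct (Hf' (- l) ltac:(lra)) as [d Hd].
  assert (Hm : 0 < Rmin d e) by (apply Rmin_pos; [apply cond_pos | lra]).
  assert (H1 := Rmin_l d e). assert (H2 := Rmin_r d e).
  set (h := Rmin d e / 2).
  assert (Hh : 0 < h) by (unfold h; lra).
  destruct (MVT_cor2 f f' x (x + h)) as (c & Heq & Hc); [lra| |].
  - intros y Hy. apply is_derive_Reals, Hf. apply Rabs_lt_between'. unfold h in *. lra.
  - assert (f x <= f (x + h)).
    { apply Hmin. replace (x + h - x) with h by ring. rewrite Rabs_pos_eq; unfold h; lra. }
    specialize (Hd (c - x) ltac:(lra) ltac:(rewrite Rabs_pos_eq; unfold h in *; lra)).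
    replace (x + (c - x)) with c in Hd by ring. rewrite H0 in Hd.
    apply Rabs_lt_between in Hd.
    assert (0 <= f' c) by nra.
    assert (0 <= (f' c - 0) / (c - x)) by (apply Rdiv_le_0_compat; lra). lra.
Qed.

(* At a minimum of [u + eta (t - t0)] off the parabolic boundary, [us = 0], [uss >= 0] and
   [ut <= - eta], against the equation. *)
Lemma heat_min_principle (u us uss ut : R -> R -> R) (a b t0 t1 l r d : R) :
  0 <= a -> t0 <= t1 -> l <= r ->
  (forall t s, t0 <= t <= t1 -> l <= s <= r -> continuity_2d_pt u t s) ->
  (forall t s, t0 <= t <= t1 -> l <= s <= r ->
     is_derive (u t) s (us t s) /\ is_derive (us t) s (uss t s) /\
     is_derive (fun t' => u t' s) t (ut t s) /\ ut t s = a * uss t s + b * us t s) ->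
  (forall s, l <= s <= r -> d <= u t0 s) ->
  (forall t, t0 <= t <= t1 -> d <= u t l /\ d <= u t r) ->
  forall t s, t0 <= t <= t1 -> l <= s <= r -> d <= u t s.
Proof.
  intros Ha Ht Hlr Hc Hpde Hinit Hlat t s Hts Hss.
  apply Rnot_lt_le. intros Hlt.
  (* With this slope the perturbation stays below half of the deficit [d - u t s]; the [+ 1] covers
     [t0 = t1]. *)
  set (eta := (d - u t s) / (2 * (t1 - t0 + 1))).
  assert (He : 0 < eta) by (apply Rdiv_lt_0_compat; lra).
  assert (He1 : eta * (t1 - t0 + 1) = (d - u t s) / 2) by (unfold eta; field; lra).
  set (v := fun t s => u t s + eta * (t - t0)).
  destruct (rect_min v t0 t1 l r Ht Hlr) as (tm & sm & Htm & Hsm & Hmin).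
  { intros x y Hx Hy. unfold v. apply continuity_2d_pt_plus; [now apply Hc|].
    apply continuity_2d_pt_mult; [apply continuity_2d_pt_const|].
    apply continuity_2d_pt_minus; [apply continuity_2d_pt_id1 | apply continuity_2d_pt_const]. }
  assert (Hvd : v tm sm < d).
  { apply Rle_lt_trans with (v t s); [now apply Hmin|]. unfold v. nra. }
  assert (Hge : u tm sm <= v tm sm) by (unfold v; nra).
  assert (t0 < tm).
  { destruct (Req_dec tm t0) as [->|]; [|lra]. specialize (Hinit sm Hsm). lra. }
  assert (l < sm < r).
  { destruct (Hlat tm Htm) as [H1 H2].
    destruct (Req_dec sm l) as [->|]; [lra|]. destruct (Req_dec sm r) as [->|]; lra. }
  destruct (Hpde tm sm Htm Hsm) as (H1 & H2 & H3 & H4).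
  set (e := Rmin (sm - l) (r - sm)).
  assert (Hep : 0 < e) by (apply Rmin_pos; lra).
  assert (Hel : e <= sm - l) by apply Rmin_l. assert (Her : e <= r - sm) by apply Rmin_r.
  assert (Hloc : forall y, Rabs (y - sm) < e -> l <= y <= r).
  { intros y Hy. apply Rabs_lt_between' in Hy. lra. }
  assert (Hminx : forall y, Rabs (y - sm) < e -> u tm sm <= u tm y).
  { intros y Hy. specialize (Hmin tm y Htm (Hloc y Hy)). unfold v in Hmin. lra. }
  assert (Es : us tm sm = 0) by (apply (deriv_interior_min (u tm) sm _ e); auto).
  assert (Ess : 0 <= uss tm sm).
  { apply (deriv2_interior_min (u tm) (us tm) sm _ e); auto.
    intros y Hy. apply (Hpde tm y Htm (Hloc y Hy)). }
  assert (Et : ut tm sm + eta <= 0).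
  { apply (deriv_left_min (fun t' => v t' sm) tm _ (tm - t0)); [|lra|].
    - unfold v. apply (is_derive_plus (fun t' => u t' sm)); [exact H3|].
      auto_derive; [trivial | ring].
    - intros y Hy. apply Hmin; lra. }
  rewrite H4, Es in Et. nra.
Qed.

Lemma psum_derive_s (w : weight) (n : nat) (p s : R) :
  is_derive (fun s => psum w n p (exp s)) s (psum (jw w) n p (exp s)).
Proof.
  induction n as [|n IH]; simpl; [auto_derive; trivial|].
  apply (is_derive_plus (fun s => psum w n p (exp s))); [exact IH|].
  unfold mono. rewrite wt_jw. auto_derive; [trivial|].
  destruct n as [|m]; [simpl; ring | simpl pred; simpl pow; ring].
Qed.

Lemma psum_derive_t (w : weight) (n : nat) (t x : R) :
  is_derive (fun t => psum w n (exp t) x) t (psum (tw w) n (exp t) x).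
Proof.
  induction n as [|n IH]; simpl; [auto_derive; trivial|].
  apply (is_derive_plus (fun t => psum w n (exp t) x)); [exact IH|].
  unfold mono. rewrite wt_tw. auto_derive; [trivial|].
  destruct (tri n) as [|m]; [simpl; ring | simpl pred; simpl pow; ring].
Qed.

(* In the variables [ln p], [ln x] this is the heat equation, because [2 tri n = n^2 + n]. *)
Lemma psum_pde (w : weight) (n : nat) (p x : R) :
  psum (tw w) n p x = 1/2 * psum (jw (jw w)) n p x + 1/2 * psum (jw w) n p x.
Proof.
  induction n as [|n IH]; simpl; [ring|].
  rewrite IH, wt_tw, !wt_jw.
  replace (INR (tri n)) with ((INR n * INR n + INR n) / 2) by (rewrite <- INR_tri; field).
  field.
Qed.

Lemma psum_continuity_2d (w : weight) (n : nat) (t s : R) :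
  continuity_2d_pt (fun t s => psum w n (exp t) (exp s)) t s.
Proof.
  induction n as [|n IH]; simpl; [apply continuity_2d_pt_const|].
  apply continuity_2d_pt_plus; [exact IH|].
  apply continuity_2d_pt_mult; [apply continuity_2d_pt_const|]. unfold mono.
  apply continuity_2d_pt_mult;
    [apply (continuity_1d_2d_pt_comp (fun t => exp t ^ tri n) (fun t _ => t));
       [|apply continuity_2d_pt_id1]
    |apply (continuity_1d_2d_pt_comp (fun s => exp s ^ n) (fun _ s => s));
       [|apply continuity_2d_pt_id2]];
    apply derivable_continuous_pt; eexists; apply is_derive_Reals; auto_derive; trivial.
Qed.

Lemma psum_min_principle (w : weight) (n : nat) (p0 p1 l r d : R) :
  0 < p0 -> 0 < l ->
  (forall x, l <= x <= r -> d <= psum w n p0 x) ->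
  (forall p, p0 <= p <= p1 -> d <= psum w n p l /\ d <= psum w n p r) ->
  forall p x, p0 <= p <= p1 -> l <= x <= r -> d <= psum w n p x.
Proof.
  intros Hp0 Hl Hinit Hlat p x Hp Hx.
  rewrite <- (exp_ln p), <- (exp_ln x) by lra.
  apply (heat_min_principle (fun t s => psum w n (exp t) (exp s))
           (fun t s => psum (jw w) n (exp t) (exp s))
           (fun t s => psum (jw (jw w)) n (exp t) (exp s))
           (fun t s => psum (tw w) n (exp t) (exp s)) (1/2) (1/2) (ln p0) (ln p1) (ln l) (ln r)).
  - lra.
  - apply ln_le; lra.
  - apply ln_le; lra.
  - intros. apply psum_continuity_2d.
  - intros t s _ _.
    exact (conj (psum_derive_s w n (exp t) s) (conj (psum_derive_s (jw w) n (exp t) s)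
      (conj (psum_derive_t w n t (exp s)) (psum_pde w n (exp t) (exp s))))).
  - intros s Hs. rewrite exp_ln by lra. apply Hinit.
    rewrite <- (exp_ln l), <- (exp_ln r) by lra. split; apply exp_le; lra.
  - intros t Ht. rewrite !(exp_ln l), !(exp_ln r) by lra. apply Hlat.
    rewrite <- (exp_ln p0), <- (exp_ln p1) by lra. split; apply exp_le; lra.
  - split; apply ln_le; lra.
  - split; apply ln_le; lra.
Qed.

(** A partial sum within a third of the supposed deficit of [U], uniformly on the rectangle, obeys
    the principle with [d - eps]. At the bad point this gives [U >= d - 2 eps], against a deficit of
    [3 eps]. *)
Lemma U_min_principle (w : weight) (p0 p1 l r d : R) :
  tame w -> 0 < p0 -> p1 < 1 -> 0 < l ->
  (forall x, l <= x <= r -> d <= U w p0 x) ->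
  (forall p, p0 <= p <= p1 -> d <= U w p l /\ d <= U w p r) ->
  forall p x, p0 <= p <= p1 -> l <= x <= r -> d <= U w p x.
Proof.
  intros Hw Hp0 Hp1 Hl Hinit Hlat p x Hp Hx.
  apply Rnot_lt_le. intros Hlt.
  set (eps := (d - U w p x) / 3).
  destruct (U_unif p1 r eps) as [N HN]; [lra | lra | unfold eps; lra |].
  assert (Hclose : forall p x, p0 <= p <= p1 -> l <= x <= r -> Rabs (psum w N p x - U w p x) <= eps).
  { intros. apply HN; try lra; try lia. exact Hw. }
  assert (Hle : forall p x, p0 <= p <= p1 -> l <= x <= r -> d <= U w p x -> d - eps <= psum w N p x).
  { intros p' x' H1 H2 H3. specialize (Hclose p' x' H1 H2).
    apply Rabs_le_between in Hclose. lra. }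
  assert (Hm : d - eps <= psum w N p x).
  { apply (psum_min_principle w N p0 p1 l r); try lra.
    - intros y Hy. apply Hle; try lra. now apply Hinit.
    - intros q Hq. destruct (Hlat q Hq). split; apply Hle; lra. }
  specialize (Hclose p x Hp Hx). apply Rabs_le_between in Hclose. unfold eps in *. lra.
Qed.

(** The mean value theorem is applied to partial sums whose logarithmic derivative is at least
    [d / 2]; this lower bound for the increment survives in the limit. *)
Lemma U_increasing (w : weight) (p a b d : R) :
  tame w -> tame (jw w) -> 0 <= p < 1 -> 0 < a < b -> 0 < d ->
  (forall c, a <= c <= b -> d <= U (jw w) p c) -> U w p a < U w p b.
Proof.
  intros Hw Hjw Hp Hab Hd H.
  destruct (U_unif p b (d / 2) Hp ltac:(lra) ltac:(lra)) as [N HN].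
  assert (0 < ln b - ln a) by (assert (ln a < ln b) by (apply ln_increasing; lra); lra).
  assert (Hn : forall n, (N <= n)%nat -> d / 2 * (ln b - ln a) <= psum w n p b - psum w n p a).
  { intros n Hn.
    destruct (MVT_cor2 (fun s => psum w n p (exp s)) (fun s => psum (jw w) n p (exp s))
      (ln a) (ln b)) as (c & Heq & Hc); [lra| |].
    - intros c _. apply is_derive_Reals, psum_derive_s.
    - rewrite !exp_ln in Heq by lra. rewrite Heq.
      apply Rmult_le_compat_r; [lra|].
      assert (a <= exp c <= b).
      { rewrite <- (exp_ln a), <- (exp_ln b) by lra. split; apply exp_le; lra. }
      specialize (HN (jw w) p (exp c) n Hjw ltac:(lra) ltac:(lra) Hn).
      specialize (H (exp c) ltac:(lra)). apply Rabs_le_between in HN. lra. }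
  assert (Hl : is_lim_seq (fun n => psum w n p b - psum w n p a) (U w p b - U w p a)).
  { apply is_lim_seq_minus'; apply U_lim; auto; lra. }
  assert (d / 2 * (ln b - ln a) <= U w p b - U w p a).
  { apply (is_lim_seq_le_loc (fun _ => d / 2 * (ln b - ln a))
      (fun n => psum w n p b - psum w n p a)
      (d / 2 * (ln b - ln a)) (U w p b - U w p a));
      [exists N; exact Hn | apply is_lim_seq_const | exact Hl]. }
  nra.
Qed.

(** * Verified evaluation *)

(** Fixed-point numbers with unit [2^-24], [2^24 = 16777216]. *)
Definition encl (v : R) (l h : Z) : Prop := IZR l <= v * 16777216 <= IZR h.

Definition fmul_lo (a b : Z) : Z := Z.shiftr (a * b) 24.
Definition fmul_hi (a b : Z) : Z := (Z.shiftr (a * b) 24 + 1)%Z.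

Arguments fmul_lo : simpl never.
Arguments fmul_hi : simpl never.

Lemma fmul_encl (u v : R) (ul uh vl vh : Z) :
  (0 <= ul)%Z -> (0 <= vl)%Z -> encl u ul uh -> encl v vl vh ->
  encl (u * v) (fmul_lo ul vl) (fmul_hi uh vh) /\ (0 <= fmul_lo ul vl)%Z.
Proof.
  intros Hu0 Hv0 [Hu1 Hu2] [Hv1 Hv2].
  unfold fmul_lo, fmul_hi. rewrite !Z.shiftr_div_pow2 by lia.
  change (2 ^ 24)%Z with 16777216%Z.
  assert (Hul : 0 <= IZR ul) by now apply (IZR_le 0).
  assert (Hvl : 0 <= IZR vl) by now apply (IZR_le 0).
  assert (H1 : IZR (ul * vl / 16777216 * 16777216) <= IZR (ul * vl)).
  { apply IZR_le. assert (H := Z.mul_div_le (ul * vl) 16777216 ltac:(lia)). lia. }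
  assert (H2 : IZR (uh * vh) <= IZR ((uh * vh / 16777216 + 1) * 16777216)).
  { apply IZR_le. assert (H := Z.mul_succ_div_gt (uh * vh) 16777216 ltac:(lia)). lia. }
  rewrite !mult_IZR in H1, H2.
  split; [split|apply Z.div_pos; nia].
  - assert (IZR ul * IZR vl <= (u * 16777216) * (v * 16777216))
      by (apply Rmult_le_compat; lra). lra.
  - assert ((u * 16777216) * (v * 16777216) <= IZR uh * IZR vh)
      by (apply Rmult_le_compat; lra). lra.
Qed.

(** The state after [n] terms: the index, the exponent [tri n], and enclosures of [p ^ n],
    [mono p x n] and the partial sum. *)
Record st := St { st_j : Z; st_t : Z; st_rl : Z; st_rh : Z; st_ml : Z; st_mh : Z;
                  st_lo : Z; st_hi : Z }.

Fixpoint ev (w : weight) (pl ph xl xh : Z) (n : nat) : st :=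
  match n with
  | O => St 0 0 16777216 16777216 16777216 16777216 0 0
  | S n =>
      let (j, t, rl, rh, ml, mh, lo, hi) := ev w pl ph xl xh n in
      let c := w j t in
      let rl' := fmul_lo rl pl in
      let rh' := fmul_hi rh ph in
      St (Z.succ j) (t + Z.succ j) rl' rh' (fmul_lo ml (fmul_lo rl' xl)) (fmul_hi mh (fmul_hi rh' xh))
        (lo + c * (if (0 <=? c)%Z then ml else mh)) (hi + c * (if (0 <=? c)%Z then mh else ml))
  end.

Lemma ev_sound (w : weight) (pl ph xl xh : Z) (n : nat) (p x : R) :
  (0 <= pl)%Z -> (0 <= xl)%Z -> encl p pl ph -> encl x xl xh ->
  let s := ev w pl ph xl xh n in
  st_j s = Z.of_nat n /\ st_t s = Z.of_nat (tri n) /\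
  (0 <= st_rl s)%Z /\ (0 <= st_ml s)%Z /\
  encl (p ^ n) (st_rl s) (st_rh s) /\ encl (mono p x n) (st_ml s) (st_mh s) /\
  encl (psum w n p x) (st_lo s) (st_hi s).
Proof.
  intros Hpl Hxl Hp Hx. induction n as [|n IH].
  - simpl. unfold mono, encl. change (tri 0) with 0%nat. simpl.
    repeat split; try lia; lra.
  - cbv zeta in *. cbn [ev].
    destruct (ev w pl ph xl xh n) as [j t rl rh ml mh lo hi]. cbn in IH |- *.
    destruct IH as (Hj & Ht & Hrl & Hml & Hr & Hm & Hs).
    destruct (fmul_encl _ _ _ _ _ _ Hrl Hpl Hr Hp) as [Hr' Hrl'].
    destruct (fmul_encl _ _ _ _ _ _ Hrl' Hxl Hr' Hx) as [Hrx Hrxl].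
    destruct (fmul_encl _ _ _ _ _ _ Hml Hrxl Hm Hrx) as [Hm' Hml'].
    refine (conj _ (conj _ (conj Hrl' (conj Hml' (conj _ (conj _ _)))))).
    + lia.
    + rewrite tri_S. lia.
    + now rewrite Rmult_comm.
    + rewrite mono_S. replace (p ^ S n) with (p ^ n * p) by (simpl; ring). exact Hm'.
    + unfold encl. rewrite !plus_IZR, !mult_IZR. unfold wt. rewrite <- Hj, <- Ht.
      destruct Hm as [Hm1 Hm2], Hs as [Hs1 Hs2].
      destruct (Z.leb_spec 0 (w j t)) as [Hc|Hc].
      * assert (0 <= IZR (w j t)) by now apply (IZR_le 0). nra.
      * assert (IZR (w j t) <= 0) by (apply (IZR_le _ 0); lia). nra.
Qed.

(** Tests [c <= psum] on a box by the mean value form around the midpoint of the [p]-range (or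
    [x]-range), with the derivative taken in logarithmic scale; by direct enclosure if that range
    touches [0]. [tl] bounds the neglected tail of the series. *)
Definition piece (in_p : bool) (w : weight) (n : nat) (c pl ph xl xh : Z) : bool :=
  let a := if in_p then pl else xl in
  let b := if in_p then ph else xh in
  let mv := ((0 <? a)%Z && (a <=? b)%Z)%bool in
  let s := ev (if mv then if in_p then tw w else jw w else w) pl ph xl xh n in
  let tl := (4 * (Z.of_nat n + 1) * st_mh s)%Z in
  if negb ((0 <=? pl)%Z && (ph <=? 16777216)%Z && (0 <=? xl)%Z
           && (4 * (Z.of_nat n + 2) * st_rh s * xh
               <=? 3 * (Z.of_nat n + 1) * 16777216 * 16777216)%Z)%bool
  then false
  else if mv then
    let m := ((a + b) / 2)%Z in
    let s0 := if in_p then ev w m m xl xh n else ev w pl ph m m n in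
    (c + tl + (Z.max (- st_lo s) (st_hi s) * (b - m) / a + 1) <=? st_lo s0)%Z
  else (c + tl <=? st_lo s)%Z.

(** Logarithmic derivatives only change the weight, so the same evaluator encloses them. The
    distance of logarithms is bounded by [ln (v / u) <= (v - u) / u]. The hypothesis
    [m - a <= b - m] holds because the integer midpoint is rounded down. *)
Lemma log_mvt (f f' : R -> R) (a b m y D : R) :
  (forall t, is_derive (fun t => f (exp t)) t (f' (exp t))) ->
  0 < a -> a <= m <= b -> m - a <= b - m -> a <= y <= b ->
  (forall z, a <= z <= b -> Rabs (f' z) <= D) -> f m - D * ((b - m) / a) <= f y.
Proof.
  intros Hf Ha Hm Hma Hy HD.
  assert (HD0 : 0 <= D) by (specialize (HD m Hm); assert (H := Rabs_pos (f' m)); lra).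
  assert (Hln : forall u v, a <= u -> u <= v -> v - u <= b - m -> ln v - ln u <= (b - m) / a).
  { intros u v Hu Huv Hd. rewrite <- ln_div by lra.
    apply Rle_trans with (v / u - 1).
    - assert (H := exp_ineq1_le (ln (v / u))).
      rewrite exp_ln in H by (apply Rdiv_lt_0_compat; lra). lra.
    - replace (v / u - 1) with ((v - u) / u) by (field; lra).
      apply Rmult_le_compat; try lra; [left; apply Rinv_0_lt_compat; lra|].
      apply Rinv_le_contravar; lra. }
  assert (Hmono : forall u v, a <= u < v -> v <= b -> v - u <= b - m ->
            Rabs (f v - f u) <= D * ((b - m) / a)).
  { intros u v Hu Hv Hd.
    destruct (MVT_cor2 (fun s => f (exp s)) (fun s => f' (exp s)) (ln u) (ln v))
      as (c & Heq & Hc); [apply ln_increasing; lra| |].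
    - intros c _. apply is_derive_Reals, Hf.
    - rewrite !exp_ln in Heq by lra. rewrite Heq, Rabs_mult.
      apply Rmult_le_compat; try apply Rabs_pos.
      + apply HD. assert (u <= exp c <= v).
        { rewrite <- (exp_ln u), <- (exp_ln v) by lra. split; apply exp_le; lra. } lra.
      + assert (ln u < ln v) by (apply ln_increasing; lra).
        rewrite Rabs_pos_eq by lra. apply Hln; lra. }
  destruct (Rtotal_order m y) as [H|[<-|H]].
  - assert (H1 := Hmono m y ltac:(lra) ltac:(lra) ltac:(lra)).
    apply Rabs_le_between in H1. lra.
  - assert (0 <= (b - m) / a) by (apply Rdiv_le_0_compat; lra). nra.
  - assert (H1 := Hmono y m ltac:(lra) ltac:(lra) ltac:(lra)).
    apply Rabs_le_between in H1. lra.
Qed.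

Lemma encl_abs (v : R) (l h : Z) :
  encl v l h -> Rabs v <= IZR (Z.max (- l) h) / 16777216.
Proof.
  intros [H1 H2].
  assert (IZR (- l) <= IZR (Z.max (- l) h)) by (apply IZR_le; lia).
  assert (IZR h <= IZR (Z.max (- l) h)) by (apply IZR_le; lia).
  rewrite opp_IZR in *. apply Rabs_le. lra.
Qed.

(** The bound holds for every later partial sum, which is what [U_ge] turns into a bound for the
    limit. *)
Lemma piece_sound (in_p : bool) (w : weight) (n k : nat) (c pl ph xl xh : Z) (p x : R) :
  tame w -> piece in_p w n c pl ph xl xh = true -> encl p pl ph -> encl x xl xh -> (n <= k)%nat ->
  IZR c <= psum w k p x * 16777216.
Proof.
  intros Hw Hpc Hp Hx Hk. unfold piece in Hpc.
  set (a := if in_p then pl else xl) in *. set (b := if in_p then ph else xh) in *.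
  set (mv := ((0 <? a)%Z && (a <=? b)%Z)%bool) in *.
  set (s := ev (if mv then if in_p then tw w else jw w else w) pl ph xl xh n) in *.
  destruct (_ && _ && _ && _)%bool eqn:Hg; cbn [negb] in Hpc; [|discriminate].
  rewrite !Bool.andb_true_iff, !Z.leb_le in Hg. destruct Hg as [[[Hg1 Hg2] Hg3] Hg4].
  assert (Hev := ev_sound (if mv then if in_p then tw w else jw w else w)
    pl ph xl xh n p x Hg1 Hg3 Hp Hx).
  cbv zeta in Hev. fold s in Hev. destruct Hev as (_ & _ & _ & _ & Hr & Hm & Hs).
  assert (Hp1 : 0 <= p <= 1).
  { destruct Hp as [H1 H2]. apply (IZR_le 0) in Hg1. apply IZR_le in Hg2. lra. }
  assert (Hx0 : 0 <= x).
  { destruct Hx as [H1 H2]. apply (IZR_le 0) in Hg3. lra. }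
  assert (Htail := psum_tail w n k p x Hw Hp1 Hx0).
  rewrite INR_IZR_INZ in Htail.
  apply IZR_le in Hg4. rewrite !mult_IZR, !plus_IZR in Hg4.
  assert (Hn0 : 0 <= IZR (Z.of_nat n)) by (apply (IZR_le 0); lia).
  assert (Hrx : p ^ n * 16777216 * (x * 16777216)
                <= IZR (st_rh s) * IZR xh).
  { destruct Hr as [_ Hr2], Hx as [_ Hx2].
    apply Rmult_le_compat; try assumption; try lra.
    apply Rmult_le_pos; [apply pow_le|]; lra. }
  assert (Htail2 := Htail ltac:(nra) Hk). clear Htail.
  assert (Htl : Rabs (psum w k p x - psum w n p x) * 16777216
    <= IZR (4 * (Z.of_nat n + 1) * st_mh s)).
  { rewrite !mult_IZR, plus_IZR. destruct Hm as [_ Hm2].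
    assert (4 * (IZR (Z.of_nat n) + 1) * (mono p x n * 16777216) <=
      4 * (IZR (Z.of_nat n) + 1) * IZR (st_mh s))
      by (apply Rmult_le_compat_l; lra). lra. }
  clear Htail2 Hr Hm Hrx Hg4.
  set (tl := (4 * (Z.of_nat n + 1) * st_mh s)%Z) in *.
  assert (Hdiff : psum w n p x * 16777216 - IZR tl <= psum w k p x * 16777216).
  { assert (H := Rle_abs (- (psum w k p x - psum w n p x))). rewrite Rabs_Ropp in H. lra. }
  destruct mv eqn:E2.
  2: { apply Z.leb_le, IZR_le in Hpc. rewrite plus_IZR in Hpc. destruct Hs. lra. }
  set (m := ((a + b) / 2)%Z) in *.
  set (s0 := if in_p then ev w m m xl xh n else ev w pl ph m m n) in *.
  unfold mv in E2.
  rewrite Bool.andb_true_iff, Z.ltb_lt, Z.leb_le in E2. destruct E2 as [Ea Eab].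
  apply Z.leb_le, IZR_le in Hpc. rewrite !plus_IZR in Hpc.
  assert (Hmab : (a <= m <= b /\ m - a <= b - m)%Z).
  { assert (H := Z.div_mod (a + b) 2 ltac:(lia)).
    assert (H' := Z.mod_pos_bound (a + b) 2 ltac:(lia)). fold m in H. lia. }
  destruct Hmab as [[Hm1 Hm2] Hm3].
  apply IZR_le in Hm1, Hm2, Hm3. rewrite !minus_IZR in Hm3.
  assert (HaR : 0 < IZR a) by now apply (IZR_lt 0).
  set (D := Z.max (- st_lo s) (st_hi s)) in *.
  assert (Hq : IZR D * ((IZR b - IZR m) / IZR a) <= IZR (D * (b - m) / a) + 1).
  { assert (H := Z.mul_succ_div_gt (D * (b - m)) a Ea).
    apply Z.lt_le_incl, IZR_le in H.
    rewrite !mult_IZR, succ_IZR, minus_IZR in H.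
    replace (IZR D * ((IZR b - IZR m) / IZR a)) with (IZR D * (IZR b - IZR m) / IZR a)
      by (field; lra).
    apply Rle_div_l; lra. }
  set (q := 16777216) in *.
  assert (Hq0 : 0 < q) by (unfold q; lra).
  assert (Hmain : IZR (st_lo s0) - IZR D * ((IZR b - IZR m) / IZR a) <= psum w n p x * q).
  { assert (Hratio : (IZR b / q - IZR m / q) / (IZR a / q) = (IZR b - IZR m) / IZR a)
      by (field; lra).
    assert (Hin : forall v, encl v a b -> IZR a / q <= v <= IZR b / q).
    { intros v [H1 H2]. split; [apply Rle_div_l|apply Rle_div_r]; assumption. }
    assert (Hin' : forall v, IZR a / q <= v <= IZR b / q -> encl v a b).
    { intros v [H1 H2]. apply Rle_div_l in H1; [|lra]. apply Rle_div_r in H2; [|lra].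
      now split. }
    assert (Hmm : encl (IZR m / q) m m) by (unfold encl; fold q; split; right; field; lra).
    assert (Hqm : forall u v, u <= v -> u / q <= v / q).
    { intros u v Huv. apply Rmult_le_compat_r; [left; now apply Rinv_0_lt_compat | lra]. }
    assert (Hrest : IZR a / q <= IZR m / q <= IZR b / q /\
      IZR m / q - IZR a / q <= IZR b / q - IZR m / q /\ 0 < IZR a / q).
    { split; [split; now apply Hqm|split].
      - assert (H := Hqm _ _ Hm3). unfold Rdiv in *. lra.
      - apply Rdiv_lt_0_compat; lra. }
    destruct Hrest as (Hr1 & Hr2 & Hr3).
    destruct in_p.
    - assert (H := log_mvt (fun p => psum w n p x) (fun p => psum (tw w) n p x)
        (IZR a / q) (IZR b / q) (IZR m / q) p (IZR D / q)
        (fun t => psum_derive_t w n t x) Hr3 Hr1 Hr2 (Hin p Hp)).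
      rewrite Hratio in H.
      assert (Hev0 := ev_sound w m m xl xh n (IZR m / q) x ltac:(apply le_IZR; lra) Hg3 Hmm Hx).
      cbv zeta in Hev0. destruct Hev0 as (_ & _ & _ & _ & _ & _ & [Hs0 _]).
      fold q in Hs0. fold s0 in Hs0.
      assert (H' : psum w n (IZR m / q) x - IZR D / q * ((IZR b - IZR m) / IZR a)
                   <= psum w n p x).
      { apply H. intros z Hz. apply encl_abs.
        apply (ev_sound (tw w) pl ph xl xh n z x Hg1 Hg3 (Hin' z Hz) Hx). }
      apply (Rmult_le_compat_r q) in H'; [|lra].
      replace ((psum w n (IZR m / q) x - IZR D / q * ((IZR b - IZR m) / IZR a)) * q)
        with (psum w n (IZR m / q) x * q - IZR D * ((IZR b - IZR m) / IZR a)) in H'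
        by (field; lra). lra.
    - assert (H := log_mvt (fun x => psum w n p x) (fun x => psum (jw w) n p x)
        (IZR a / q) (IZR b / q) (IZR m / q) x (IZR D / q)
        (fun t => psum_derive_s w n p t) Hr3 Hr1 Hr2 (Hin x Hx)).
      rewrite Hratio in H.
      assert (Hev0 := ev_sound w pl ph m m n p (IZR m / q) Hg1 ltac:(apply le_IZR; lra) Hp Hmm).
      cbv zeta in Hev0. destruct Hev0 as (_ & _ & _ & _ & _ & _ & [Hs0 _]).
      fold q in Hs0. fold s0 in Hs0.
      assert (H' : psum w n p (IZR m / q) - IZR D / q * ((IZR b - IZR m) / IZR a)
                   <= psum w n p x).
      { apply H. intros z Hz. apply encl_abs.
        apply (ev_sound (jw w) pl ph xl xh n p z Hg1 Hg3 Hp (Hin' z Hz)). }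
      apply (Rmult_le_compat_r q) in H'; [|lra].
      replace ((psum w n p (IZR m / q) - IZR D / q * ((IZR b - IZR m) / IZR a)) * q)
        with (psum w n p (IZR m / q) * q - IZR D * ((IZR b - IZR m) / IZR a)) in H'
        by (field; lra). lra. }
  lra.
Qed.

Fixpoint bisect (chk : Z -> Z -> bool) (fuel : nat) (a b : Z) : bool :=
  if chk a b then true
  else match fuel with
       | O => false
       | S f => let m := ((a + b) / 2)%Z in
                if bisect chk f a m then bisect chk f m b else false
       end.

Lemma bisect_sound (chk : Z -> Z -> bool) (P : R -> Prop) (fuel : nat) (a b : Z) :
  (forall a b v, chk a b = true -> encl v a b -> P v) ->
  bisect chk fuel a b = true -> forall v, encl v a b -> P v.
Proof.
  intros H. revert a b. induction fuel as [|f IH]; intros a b Hb v Hv; simpl in Hb;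
    destruct (chk a b) eqn:E; try discriminate; try (now apply (H a b)).
  destruct (bisect chk f a ((a + b) / 2)) eqn:E1; [|discriminate].
  destruct (Rle_lt_dec (v * 16777216) (IZR ((a + b) / 2))) as [Hl|Hl].
  - apply (IH a ((a + b) / 2)%Z E1). destruct Hv. now split.
  - apply (IH ((a + b) / 2)%Z b Hb). destruct Hv. split; [lra|assumption].
Qed.

Lemma psum_ge_p (w : weight) (n k : nat) (c a b xl xh : Z) (p x : R) :
  tame w -> bisect (fun a b => piece true w n c a b xl xh) 22 a b = true ->
  encl p a b -> encl x xl xh -> (n <= k)%nat -> IZR c / 16777216 <= psum w k p x.
Proof.
  intros Hw Hb Hp Hx Hk. apply Rle_div_l; [lra|].
  apply (bisect_sound _ (fun p => IZR c <= psum w k p x * 16777216) _ _ _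
    (fun u v p H Hv => piece_sound true w n k c u v xl xh p x Hw H Hv Hx Hk) Hb p Hp).
Qed.

Lemma psum_ge_x (w : weight) (n k : nat) (c a b pl ph : Z) (p x : R) :
  tame w -> bisect (fun a b => piece false w n c pl ph a b) 22 a b = true ->
  encl p pl ph -> encl x a b -> (n <= k)%nat -> IZR c / 16777216 <= psum w k p x.
Proof.
  intros Hw Hb Hp Hx Hk. apply Rle_div_l; [lra|].
  apply (bisect_sound _ (fun x => IZR c <= psum w k p x * 16777216) _ _ _
    (fun u v x H Hv => piece_sound false w n k c pl ph u v p x Hw H Hp Hv Hk) Hb x Hx).
Qed.

Lemma U_ge_p (w : weight) (n : nat) (c a b xl xh : Z) (p x d : R) :
  tame w -> bisect (fun a b => piece true w n c a b xl xh) 22 a b = true ->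
  encl p a b -> encl x xl xh -> 0 <= p < 1 -> 0 <= x -> d <= IZR c / 16777216 ->
  d <= U w p x.
Proof.
  intros Hw Hb Hp Hx Hp1 Hx0 Hd. apply U_ge with n; try assumption.
  intros k Hk. eapply Rle_trans; [exact Hd|]. now apply (psum_ge_p w n k c a b xl xh).
Qed.

Lemma U_ge_x (w : weight) (n : nat) (c a b pl ph : Z) (p x d : R) :
  tame w -> bisect (fun a b => piece false w n c pl ph a b) 22 a b = true ->
  encl p pl ph -> encl x a b -> 0 <= p < 1 -> 0 <= x -> d <= IZR c / 16777216 ->
  d <= U w p x.
Proof.
  intros Hw Hb Hp Hx Hp1 Hx0 Hd. apply U_ge with n; try assumption.
  intros k Hk. eapply Rle_trans; [exact Hd|]. now apply (psum_ge_x w n k c a b pl ph).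
Qed.

(** * One-variable inequalities on the edges of the rectangles *)

Lemma tame_sp : tame sp.
Proof. apply tame_unimodular, unimodular_sp. Qed.
Lemma tame_sm : tame sm.
Proof. apply tame_unimodular, unimodular_sm. Qed.
Lemma tame_sn : tame sn.
Proof. apply tame_unimodular, unimodular_sn. Qed.
Lemma tame_jw_sp : tame (jw sp).
Proof. apply tame_jw, unimodular_sp. Qed.
Lemma tame_jw_sn : tame (jw sn).
Proof. apply tame_jw, unimodular_sn. Qed.
Lemma tame_j1w_sn : tame (j1w sn).
Proof. apply tame_j1w, unimodular_sn. Qed.

(** All integers are in units of [2^-24]: [c] is the claimed bound rounded up, [a], [b] enclose the
    range that is bisected, and [u], [v] enclose the other argument. *)
Ltac numeric lem w n c a b u v T :=
  apply (lem w n c a b u v);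
  [ exact T | vm_cast_no_check (eq_refl true) | unfold encl; lra | unfold encl; lra
  | lra | lra | lra ].

Lemma num_sm_24 (p : R) : 0 <= p <= 3/4 -> 1/100 <= U sm p (12/5).
Proof.
  intros Hp. numeric U_ge_p sm 20%nat 167773%Z 0%Z 12582912%Z 40265318%Z 40265319%Z tame_sm.
Qed.

Lemma num_sm_31 (p : R) : 3/4 <= p <= 181/200 -> 1/200 <= U sm p (31/10).
Proof.
  intros Hp. numeric U_ge_p sm 32%nat 83887%Z 12582912%Z 15183381%Z 52009369%Z 52009370%Z tame_sm.
Qed.

Lemma num_sn_32a (p : R) : 39/50 <= p <= 4/5 -> 151/10000 <= U sn p (16/5).
Proof.
  intros Hp. numeric U_ge_p sn 22%nat 253336%Z 13086228%Z 13421773%Z 53687091%Z 53687092%Z tame_sn.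
Qed.

Lemma num_sn_32b (p : R) : 4/5 <= p <= 181/200 -> 151/10000 <= U sn p (16/5).
Proof.
  intros Hp. numeric U_ge_p sn 32%nat 253336%Z 13421772%Z 15183381%Z 53687091%Z 53687092%Z tame_sn.
Qed.

Lemma num_sn_24 (p : R) : 3/5 <= p <= 4/5 -> 1/100 <= U sn p (12/5).
Proof.
  intros Hp. numeric U_ge_p sn 20%nat 167773%Z 10066329%Z 13421773%Z 40265318%Z 40265319%Z tame_sn.
Qed.

Lemma num_sn_15 (p : R) : 3/5 <= p <= 181/200 -> 1/100 <= U sn p (3/2).
Proof.
  intros Hp. numeric U_ge_p sn 20%nat 167773%Z 10066329%Z 15183381%Z 25165824%Z 25165824%Z tame_sn.
Qed.

Lemma num_jsn_15 (p : R) : 1/10 <= p <= 181/200 -> 1/100 <= U (jw sn) p (3/2).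
Proof.
  intros Hp. numeric U_ge_p (jw sn) 22%nat 167773%Z 1677721%Z 15183381%Z 25165824%Z 25165824%Z tame_jw_sn.
Qed.

Lemma num_jsn_24 (p : R) : 1/10 <= p <= 3/5 -> 1/100 <= U (jw sn) p (12/5).
Proof.
  intros Hp. numeric U_ge_p (jw sn) 16%nat 167773%Z 1677721%Z 10066330%Z 40265318%Z 40265319%Z tame_jw_sn.
Qed.

Lemma row_sm_75 (x : R) : 0 <= x <= 31/10 -> 1/200 <= U sm (3/4) x.
Proof.
  intros Hx. numeric U_ge_x sm 20%nat 83887%Z 0%Z 52009370%Z 12582912%Z 12582912%Z tame_sm.
Qed.

Lemma row_sn_80 (x : R) : 3/2 <= x <= 16/5 -> 1/100 <= U sn (4/5) x.
Proof.
  intros Hx. numeric U_ge_x sn 20%nat 167773%Z 25165824%Z 53687092%Z 13421772%Z 13421773%Z tame_sn.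
Qed.

Lemma row_sn_60 (x : R) : 3/2 <= x <= 12/5 -> 1/100 <= U sn (3/5) x.
Proof.
  intros Hx. numeric U_ge_x sn 16%nat 167773%Z 25165824%Z 40265319%Z 10066329%Z 10066330%Z tame_sn.
Qed.

(** At [q = -0.78] five consecutive intervals alternate a direction with a sign: theta decreases, is
    negative, increases, is positive, decreases. Each of the three monotone stretches carries
    exactly one zero. *)
Lemma row_78a (x : R) : 1/10 <= x <= 8/5 -> 1/1000 <= U (jw sn) (39/50) x.
Proof.
  intros Hx. numeric U_ge_x (jw sn) 20%nat 16778%Z 1677721%Z 26843546%Z 13086228%Z 13086229%Z tame_jw_sn.
Qed.

Lemma row_78b (x : R) : 8/5 <= x <= 2 -> 1/1000 <= U sn (39/50) x.
Proof.
  intros Hx. numeric U_ge_x sn 20%nat 16778%Z 26843545%Z 33554432%Z 13086228%Z 13086229%Z tame_sn.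
Qed.

Lemma row_78c (x : R) : 2 <= x <= 57/20 -> 1/1000 <= U (jw sp) (39/50) x.
Proof.
  intros Hx. numeric U_ge_x (jw sp) 20%nat 16778%Z 33554432%Z 47815066%Z 13086228%Z 13086229%Z tame_jw_sp.
Qed.

Lemma row_78d (x : R) : 57/20 <= x <= 61/20 -> 1/1000 <= U sp (39/50) x.
Proof.
  intros Hx. numeric U_ge_x sp 20%nat 16778%Z 47815065%Z 51170509%Z 13086228%Z 13086229%Z tame_sp.
Qed.

Lemma row_78e (x : R) : 61/20 <= x <= 16/5 -> 1/1000 <= U (jw sn) (39/50) x.
Proof.
  intros Hx. numeric U_ge_x (jw sn) 20%nat 16778%Z 51170508%Z 53687092%Z 13086228%Z 13086229%Z tame_jw_sn.
Qed.

(** The argument is [1/x] with [x = 3.2], and below [x = 1.5]. Since it is less than [1], the tail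
    condition can be met even at [p = 1], the right end of the enclosure. *)
Lemma inv_32 (p : R) : 9/10 <= p < 1 -> 59/100 <= U sp p (5/16).
Proof.
  intros Hp. numeric U_ge_p sp 12%nat 9898558%Z 15099494%Z 16777216%Z 5242880%Z 5242880%Z tame_sp.
Qed.

Lemma inv_15 (p : R) : 9/10 <= p < 1 -> 15/100 <= U sp p (2/3).
Proof.
  intros Hp. numeric U_ge_p sp 34%nat 2516583%Z 15099494%Z 16777216%Z 11184810%Z 11184811%Z tame_sp.
Qed.

Lemma inv_15d (p : R) : 9/10 <= p < 1 -> 1/5 <= U (j1w sn) p (2/3).
Proof.
  intros Hp. numeric U_ge_p (j1w sn) 40%nat 3355444%Z 15099494%Z 16777216%Z 11184810%Z 11184811%Z tame_j1w_sn.
Qed.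

(** * The bilateral series near q = -1 *)

Definition half (j : nat) : R := INR j + 1/2.

(** The terms [j] and [-1 - j] of the bilateral theta series, centred at [half j] and
    [- half j], carry the same sign. *)
Fixpoint bil (f : R -> R) (n : nat) (r : R) : R :=
  match n with
  | O => 0
  | S m => bil f m r + wt sp m * (f (half m - r) + f (- half m - r))
  end.

Lemma wt_sp_SS (j : nat) : wt sp (S (S j)) = - wt sp j.
Proof.
  rewrite !wt_sp. rewrite !tri_S. rewrite !pow_add.
  replace (S (S j)) with (1 + S j)%nat by lia. rewrite pow_add.
  replace ((-1) ^ tri j * (-1) ^ S j * ((-1) ^ 1 * (-1) ^ S j))
    with (- (-1) ^ tri j * ((-1) ^ S j * (-1) ^ S j)) by ring.
  rewrite <- Rpow_mult_distr. replace (-1 * -1) with 1 by ring. rewrite pow1. ring.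
Qed.

(* Shifting the index by [2] flips all signs, so the bilateral series is antiperiodic with
   antiperiod [2]; this is what is left at the two ends of a partial sum. *)
Definition edge (f : R -> R) (n : nat) (r : R) : R :=
  - wt sp (S n) * (f (half n - 1 - r) + f (- half n - 1 - r))
  - wt sp n * (f (half n - 2 - r) + f (- half n - r)).

Lemma bil_shift (f : R -> R) (n : nat) (r : R) :
  bil f n (r + 2) + bil f n r = edge f n r.
Proof.
  induction n as [|n IH].
  - unfold edge. cbn [bil]. rewrite !wt_sp, tri_S. change (tri 0) with 0%nat.
    unfold half. simpl.
    replace (0 + 1/2 - 2 - r) with (- (0 + 1/2) - 1 - r) by field.
    replace (0 + 1/2 - 1 - r) with (- (0 + 1/2) - r) by field. ring.
  - cbn [bil].
    replace (bil f n (r + 2) + wt sp n * (f (half n - (r + 2)) + f (- half n - (r + 2))) +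
      (bil f n r + wt sp n * (f (half n - r) + f (- half n - r)))) with
      ((bil f n (r + 2) + bil f n r) + wt sp n * (f (half n - (r + 2)) + f (- half n - (r + 2))
       + f (half n - r) + f (- half n - r))) by ring.
    rewrite IH. unfold edge. rewrite wt_sp_SS.
    replace (half (S n)) with (half n + 1) by (unfold half; rewrite S_INR; ring).
    replace (half n + 1 - 1 - r) with (half n - r) by ring.
    replace (- (half n + 1) - 1 - r) with (- half n - (r + 2)) by ring.
    replace (half n + 1 - 2 - r) with (half n - 1 - r) by ring.
    replace (- (half n + 1) - r) with (- half n - 1 - r) by ring.
    replace (half n - (r + 2)) with (half n - 2 - r) by ring. ring.
Qed.

(** This weak rate already makes the four terms of [edge] vanish; a constant common to a family of
    functions makes them vanish uniformly over the family. *)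
Definition decay (f : R -> R) (M : R) : Prop := forall y, Rabs (f y) * Rabs y <= M.

Lemma edge_small (M r e : R) :
  0 <= M -> 0 < e -> exists N, forall f n r', decay f M -> Rabs r' <= r -> (N <= n)%nat ->
    Rabs (edge f n r') <= e.
Proof.
  intros HM He.
  destruct (nfloor_ex (Rmax 0 (4 * M / e + r + 3)) (Rmax_l _ _)) as [N [HN1 HN2]].
  exists (S N). intros f n r' Hf Hr Hn.
  assert (Hn' : INR N + 1 <= INR n) by (rewrite <- S_INR; now apply le_INR).
  assert (H4 : 4 * M / e + r + 3 < INR n).
  { eapply Rle_lt_trans; [apply (Rmax_r 0)|]. lra. }
  assert (HMe : 0 <= 4 * M / e) by (apply Rdiv_le_0_compat; lra).
  assert (Hb : forall y, INR n - 2 - r <= Rabs y -> Rabs (f y) <= e / 4).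
  { intros y Hy. specialize (Hf y).
    apply Rmult_le_reg_r with (Rabs y); [lra|].
    assert (e / 4 * (4 * M / e) <= e / 4 * Rabs y) by (apply Rmult_le_compat_l; lra).
    replace (e / 4 * (4 * M / e)) with M in * by (field; lra). lra. }
  apply Rabs_le_between in Hr.
  assert (Hw : forall j u v, Rabs (f u) <= e/4 -> Rabs (f v) <= e/4 ->
    Rabs (wt sp j * (f u + f v)) <= e / 2).
  { intros j u v Hu Hv. rewrite Rabs_mult, unimodular_sp, Rmult_1_l.
    eapply Rle_trans; [apply Rabs_triang | lra]. }
  unfold edge, half.
  assert (H1 := Hw (S n) (INR n + 1/2 - 1 - r') (- (INR n + 1/2) - 1 - r')
    ltac:(apply Hb; rewrite Rabs_pos_eq; lra)
    ltac:(apply Hb; rewrite Rabs_left1; lra)).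
  assert (H2 := Hw n (INR n + 1/2 - 2 - r') (- (INR n + 1/2) - r')
    ltac:(apply Hb; rewrite Rabs_pos_eq; lra)
    ltac:(apply Hb; rewrite Rabs_left1; lra)).
  apply Rabs_le_between in H1. apply Rabs_le_between in H2. apply Rabs_le. lra.
Qed.

(** This says that the upper limit of [Rabs (u n)] is at most [M]. Limits enter only in
    [ev_bound_lim], where they are inherited from the partial sums of theta. *)
Definition ev_bound (u : nat -> R) (M : R) : Prop :=
  forall e, 0 < e -> exists N, forall n, (N <= n)%nat -> Rabs (u n) <= M + e.

(** A step by [2] changes the sign up to an edge term that tends to [0], so a bound on [[0, 2]]
    propagates to the right. *)
Lemma bil_extend (f : R -> R) (D M : R) :
  decay f D -> (forall r, 0 <= r <= 2 -> ev_bound (fun n => bil f n r) M) ->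
  forall r, 0 <= r -> ev_bound (fun n => bil f n r) M.
Proof.
  intros Hf H.
  assert (HD : 0 <= D).
  { eapply Rle_trans; [|apply (Hf 0)]. apply Rmult_le_pos; apply Rabs_pos. }
  assert (Hk : forall k r, 0 <= r <= 2 * INR k + 2 -> ev_bound (fun n => bil f n r) M).
  { induction k as [|k IH].
    - intros r Hr. apply H. simpl in Hr. lra.
    - intros r Hr. rewrite S_INR in Hr.
      destruct (Rle_lt_dec r 2) as [Hl|Hl]; [apply H; lra|].
      intros e He.
      destruct (IH (r - 2) ltac:(lra) (e / 2) ltac:(lra)) as [N1 H1].
      destruct (edge_small D (Rabs (r - 2)) (e / 2) HD ltac:(lra)) as [N2 H2].
      exists (N1 + N2)%nat. intros n Hn.
      specialize (H1 n ltac:(lia)).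
      specialize (H2 f n (r - 2) Hf (Rle_refl _) ltac:(lia)).
      assert (Hs := bil_shift f n (r - 2)). replace (r - 2 + 2) with r in Hs by ring.
      apply Rabs_le_between in H1. apply Rabs_le_between in H2. apply Rabs_le. lra. }
  intros r Hr. destruct (nfloor_ex r Hr) as [N [HN1 HN2]].
  apply (Hk (S N)). rewrite S_INR. assert (0 <= INR N) by apply pos_INR. lra.
Qed.

(** Gaussian kernel (unnormalised) and the [y]-derivative of the heat kernel, with its own
    derivatives, up to sign and a constant. *)
Definition gker (T y : R) : R := exp (- (y * y * / (2 * T))).
Definition kker (T y : R) : R := y * gker T y / (T * sqrt T).
Definition kker1 (T y : R) : R := (1 - y * y / T) * gker T y / (T * sqrt T).
Definition kker2 (T y : R) : R := (- (3 * y) / T + y * y * y / (T * T)) * gker T y / (T * sqrt T).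

Lemma sqrtT (T : R) : 0 < T -> 0 < sqrt T /\ sqrt T * sqrt T = T.
Proof. intros. split; [now apply sqrt_lt_R0 | apply sqrt_sqrt; lra]. Qed.

Lemma gker_derive (T y : R) : 0 < T -> is_derive (gker T) y (- y / T * gker T y).
Proof. intros HT. unfold gker. auto_derive; [lra | field; lra]. Qed.

Lemma kker_derive (T y : R) : 0 < T -> is_derive (kker T) y (kker1 T y).
Proof.
  intros HT. destruct (sqrtT T HT). unfold kker, kker1, gker.
  auto_derive; [lra | field; lra].
Qed.

Lemma kker1_derive (T y : R) : 0 < T -> is_derive (kker1 T) y (kker2 T y).
Proof.
  intros HT. destruct (sqrtT T HT). unfold kker1, kker2, gker.
  auto_derive; [lra | field; lra].
Qed.

Lemma kker_derive_T (T y : R) :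
  0 < T -> is_derive (fun T => kker T y) T (1/2 * kker2 T y).
Proof.
  intros HT. destruct (sqrtT T HT) as [H1 H2]. unfold kker, kker2, gker.
  auto_derive; [repeat split; nra|].
  set (q := sqrt T) in *. rewrite <- H2. field. lra.
Qed.

Lemma kker_continuity_2d (T y c : R) :
  0 < T -> continuity_2d_pt (fun T r => kker T (c - r)) T y.
Proof.
  intros HT. destruct (sqrtT T HT).
  assert (Hy : continuity_2d_pt (fun T r => c - r) T y)
    by (apply continuity_2d_pt_minus; [apply continuity_2d_pt_const | apply continuity_2d_pt_id2]).
  unfold kker, gker, Rdiv.
  apply continuity_2d_pt_mult.
  - apply continuity_2d_pt_mult; [exact Hy|].
    apply (continuity_1d_2d_pt_comp exp).
    + apply derivable_continuous_pt, derivable_pt_exp.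
    + apply continuity_2d_pt_opp, continuity_2d_pt_mult.
      * now apply continuity_2d_pt_mult.
      * apply (continuity_1d_2d_pt_comp (fun T => / (2 * T)) (fun T _ => T));
          [|apply continuity_2d_pt_id1].
        apply derivable_continuous_pt. eexists. apply is_derive_Reals. auto_derive; [lra | reflexivity].
  - apply (continuity_1d_2d_pt_comp (fun T => / (T * sqrt T)) (fun T _ => T));
      [|apply continuity_2d_pt_id1].
    apply derivable_continuous_pt. eexists. apply is_derive_Reals.
    auto_derive; [repeat split; nra | reflexivity].
Qed.

Lemma bil_derive (f f' : R -> R) (n : nat) (r : R) :
  (forall y, is_derive f y (f' y)) -> is_derive (bil f n) r (- bil f' n r).
Proof.
  intros Hf. induction n as [|n IH]; cbn [bil]; [auto_derive; [trivial | ring]|].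
  replace (- (bil f' n r + wt sp n * (f' (half n - r) + f' (- half n - r))))
    with (- bil f' n r + wt sp n * (- f' (half n - r) + - f' (- half n - r))) by ring.
  apply (is_derive_plus (bil f n)); [exact IH|].
  apply (is_derive_scal (fun r => f (half n - r) + f (- half n - r))).
  assert (H : forall c, is_derive (fun r => f (c - r)) r (- f' (c - r))).
  { intros c. replace (- f' (c - r)) with (-1 * f' (c - r)) by ring.
    apply (is_derive_comp f (fun r => c - r)); [apply Hf|]. auto_derive; [trivial | ring]. }
  apply (is_derive_plus (fun r => f (half n - r))); apply H.
Qed.

Lemma bil_derive_T (T r : R) (n : nat) :
  0 < T -> is_derive (fun T => bil (kker T) n r) T (1/2 * bil (kker2 T) n r).
Proof.
  intros HT. induction n as [|n IH]; cbn [bil]; [auto_derive; [trivial | ring]|].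
  replace (1/2 * (bil (kker2 T) n r + wt sp n * (kker2 T (half n - r) + kker2 T (- half n - r))))
    with (1/2 * bil (kker2 T) n r
          + wt sp n * (1/2 * kker2 T (half n - r) + 1/2 * kker2 T (- half n - r))) by ring.
  apply (is_derive_plus (fun T => bil (kker T) n r)); [exact IH|].
  apply (is_derive_scal (fun T => kker T (half n - r) + kker T (- half n - r))).
  apply (is_derive_plus (fun T => kker T (half n - r))); now apply kker_derive_T.
Qed.

Lemma bil_kker_continuity_2d (T r : R) (n : nat) :
  0 < T -> continuity_2d_pt (fun T r => bil (kker T) n r) T r.
Proof.
  intros HT. induction n as [|n IH]; cbn [bil]; [apply continuity_2d_pt_const|].
  apply continuity_2d_pt_plus; [exact IH|].
  apply continuity_2d_pt_mult; [apply continuity_2d_pt_const|].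
  apply continuity_2d_pt_plus; now apply kker_continuity_2d.
Qed.

(** * Elementary estimates for the data at [T = 1/2] *)

Lemma cos_lower (a : R) : -2 <= a <= 2 -> 1 - a^2/2 + a^4/24 - a^6/720 <= cos a.
Proof.
  intros Ha. assert (H := proj1 (pre_cos_bound a 1 (proj1 Ha) (proj2 Ha))).
  eapply Rle_trans; [|exact H]. right. unfold cos_approx, cos_term. simpl. field.
Qed.

(** A tent fits under the cosine on [[0, 2]]. Its summand [1/100] is the room left at the ends,
    where [cos (31/20)] is about [0.02]. *)
Lemma cos_chord (r : R) : 0 <= r <= 2 ->
  979/1000 * (1 - Rabs (r - 1)) + 1/100 <= cos (31/20 * (r - 1)).
Proof.
  intros Hr. set (u := Rabs (r - 1)).
  assert (Hu : 0 <= u <= 1).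
  { split; [apply Rabs_pos | apply Rabs_le; lra]. }
  assert (Hu2 : (r - 1) * (r - 1) = u * u).
  { unfold u, Rabs. destruct Rcase_abs; ring. }
  eapply Rle_trans; [|apply cos_lower; lra].
  replace (1 - (31/20 * (r - 1))^2/2 + (31/20 * (r - 1))^4/24 - (31/20 * (r - 1))^6/720) with
   (1 - (31/20)^2/2*((r - 1)*(r - 1)) + (31/20)^4/24*((r - 1)*(r - 1))^2
     - (31/20)^6/720 * ((r - 1)*(r - 1))^3) by field.
  rewrite Hu2.
  assert (Hs : 0 <= u * u <= 1) by (split; [apply Rle_0_sqr | nra]).
  (* Up to a small nonnegative remainder this product is the Taylor polynomial minus the tent, after
     [u^6] is replaced by the larger [u^4]. *)
  assert (0 <= (1 - u) * (11/1000 + 98/100*u - 2212/10000*(u*u) - 2212/10000*(u*u*u))).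
  { apply Rmult_le_pos; [lra|]. assert (u*u <= u) by nra. assert (u*u*u <= u) by nra. lra. }
  assert (H6 : 0 <= (u*u) * (u*u) * (1 - u*u)) by (repeat apply Rmult_le_pos; lra).
  assert (H7 : 0 <= u * (1 - u)) by (apply Rmult_le_pos; lra).
  assert (H8 : 0 <= (u*u) * (u*u)) by (apply Rmult_le_pos; lra).
  simpl. lra.
Qed.

Lemma exp_lower3 (x : R) : 0 <= x -> 1 + x + x^2/2 + x^3/6 <= exp x.
Proof.
  intros Hx.
  set (f := fun x => exp x - (1 + x + x^2/2 + x^3/6)).
  assert (Hd2 : forall y, 0 <= y -> 1 + y + y^2/2 <= exp y).
  { intros y Hy. set (h := fun x => exp x - (1 + x + x^2/2)).
    destruct (Req_dec y 0) as [->|Hy0]; [rewrite exp_0; lra|].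
    destruct (MVT_cor2 h (fun x => exp x - (1 + x)) 0 y ltac:(lra)) as (c & Hc & Hc1).
    - intros c _. apply is_derive_Reals. unfold h. auto_derive; [trivial | field].
    - unfold h in Hc. rewrite exp_0 in Hc. assert (H := exp_ineq1_le c).
      assert (0 <= (exp c - (1 + c)) * (y - 0)) by (apply Rmult_le_pos; lra). lra. }
  destruct (Req_dec x 0) as [->|Hx0]; [rewrite exp_0; lra|].
  destruct (MVT_cor2 f (fun x => exp x - (1 + x + x^2/2)) 0 x ltac:(lra)) as (c & Hc & Hc1).
  - intros c _. apply is_derive_Reals. unfold f. auto_derive; [trivial | field].
  - unfold f in Hc. rewrite exp_0 in Hc. assert (H := Hd2 c ltac:(lra)).
    assert (0 <= (exp c - (1 + c + c^2/2)) * (x - 0)) by (apply Rmult_le_pos; lra). lra.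
Qed.

Lemma exp_mult_nat (x : R) (n : nat) : exp (INR n * x) = exp x ^ n.
Proof.
  induction n as [|n IH]; [simpl; rewrite Rmult_0_l; apply exp_0|].
  rewrite S_INR. replace ((INR n + 1) * x) with (x + INR n * x) by ring.
  rewrite exp_plus, IH. reflexivity.
Qed.

Lemma exp_lower (x : R) (n : nat) (y : R) :
  0 <= y -> x = INR n * y -> (1 + y + y^2/2 + y^3/6) ^ n <= exp x.
Proof.
  intros Hy ->. rewrite exp_mult_nat. apply pow_incr. split; [|now apply exp_lower3].
  assert (0 <= y^2) by (apply pow_le; lra). assert (0 <= y^3) by (apply pow_le; lra). lra.
Qed.

(** This is the absolute value of [kker1 (1/2) y] divided by [2 sqrt 2]; the constant [2829/1000]
    used below slightly exceeds [2 sqrt 2]. *)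
Definition psi (y : R) : R := Rabs (1 - 2 * (y * y)) * exp (- (y * y)).

Lemma psi_le_1 (y : R) : -1/2 <= y <= 1/2 -> psi y <= 1.
Proof.
  intros Hy. unfold psi. assert (0 <= y * y <= 1/2) by nra.
  rewrite <- (Rmult_1_r 1). apply Rmult_le_compat.
  - apply Rabs_pos.
  - left; apply exp_pos.
  - apply Rabs_le. lra.
  - rewrite <- exp_0. apply exp_le. lra.
Qed.

(** The outer local maximum of [psi], at [y^2 = 3/2], is [2 exp (-3/2)], just under [45/100]. Hence
    the tangent of [exp] is taken at [3/2], where the margin is smallest. *)
Lemma psi_mid (y : R) : 1/4 <= y * y -> psi y <= 45/100.
Proof.
  intros Hy. unfold psi. set (z := y * y) in *.
  assert (Hexp : exp z * exp (- z) = 1) by (rewrite <- exp_plus, Rplus_opp_r; apply exp_0).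
  assert (0 < exp (- z)) by apply exp_pos.
  enough (Rabs (1 - 2 * z) <= 45/100 * exp z) by nra.
  destruct (Rle_lt_dec z (1/2)) as [Hz|Hz].
  - rewrite Rabs_pos_eq by lra. assert (H1 := exp_ineq1_le z). lra.
  - rewrite Rabs_left1 by lra.
    assert (H1 := exp_ineq1_le (z - 3/2)).
    assert (H2 : 4447/1000 <= exp (3/2)).
    { eapply Rle_trans; [|apply (exp_lower (3/2) 4 (3/8)); [lra | simpl; lra]]. simpl. lra. }
    replace (exp z) with (exp (3/2) * exp (z - 3/2)) by (rewrite <- exp_plus; f_equal; ring).
    assert (0 < exp (z - 3/2)) by apply exp_pos. nra.
Qed.

Lemma psi_tail (y : R) : 3/2 <= y -> psi y <= 82/10 * exp (- (2 * y)).
Proof.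
  intros Hy. unfold psi.
  assert (Hw : exp (- (2 * y)) = exp (y * y - 2 * y) * exp (- (y * y)))
    by (rewrite <- exp_plus; f_equal; ring).
  rewrite Hw. assert (0 < exp (- (y * y))) by apply exp_pos.
  enough (Rabs (1 - 2 * (y * y)) <= 82/10 * exp (y * y - 2 * y)) by nra.
  rewrite Rabs_left1 by nra.
  (* The tangent of [exp] at [-3/5], close to the critical value of [y^2 - 2 y], reduces the claim
     to a quadratic inequality. *)
  assert (H1 := exp_ineq1_le (y * y - 2 * y + 3/5)).
  replace (exp (y * y - 2 * y)) with (exp (- (3/5)) * exp (y * y - 2 * y + 3/5))
    by (rewrite <- exp_plus; f_equal; ring).
  assert (H2 : 548/1000 <= exp (- (3/5))).
  { assert (H2 := exp_ineq1_le (- (3/5) / 128)).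
    replace (- (3/5)) with (INR 128 * (- (3/5) / 128)) by (simpl; field).
    rewrite exp_mult_nat. eapply Rle_trans; [|apply pow_incr; split; [|exact H2]]; [simpl; lra | lra]. }
  assert (0 < exp (y * y - 2 * y + 3/5)) by apply exp_pos.
  assert (548/1000 * (1 + (y * y - 2 * y + 3/5)) <= exp (- (3/5)) * exp (y * y - 2 * y + 3/5)).
  { apply Rmult_le_compat; try lra. assert (0 <= (y - 1) * (y - 1)) by apply Rle_0_sqr. lra. }
  assert (0 <= (y - 18/10) * (y - 18/10)) by apply Rle_0_sqr.
  assert (0 <= (y - 181/100) * (y - 181/100)) by apply Rle_0_sqr.
  lra.
Qed.

Lemma psi_geom (y : R) (k : nat) : 3/2 + INR k <= y -> psi y <= 41/100 * (136/1000) ^ k.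
Proof.
  intros Hy. assert (0 <= INR k) by apply pos_INR.
  eapply Rle_trans; [apply psi_tail; lra|].
  assert (H3 : exp (-3) <= 1/20).
  { replace (exp (-3)) with (/ exp 3) by (rewrite <- exp_Ropp; f_equal; lra).
    replace (1/20) with (/ 20) by field.
    apply Rinv_le_contravar; [lra|].
    eapply Rle_trans; [|apply (exp_lower 3 12 (1/4)); [lra | simpl; lra]]. simpl. lra. }
  assert (H2 : exp (-2) <= 136/1000).
  { replace (exp (-2)) with (/ exp 2) by (rewrite <- exp_Ropp; f_equal; lra).
    replace (136/1000) with (/ (1000/136)) by field.
    apply Rinv_le_contravar; [lra|].
    eapply Rle_trans; [|apply (exp_lower 2 8 (1/4)); [lra | simpl; lra]]. simpl. lra. }
  apply Rle_trans with (82/10 * exp (-3 + INR k * -2)).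
  - apply Rmult_le_compat_l; [lra|]. apply exp_le. lra.
  - rewrite exp_plus, exp_mult_nat.
    assert (exp (-2) ^ k <= (136/1000) ^ k)
      by (apply pow_incr; split; [left; apply exp_pos | exact H2]).
    assert (0 <= exp (-2) ^ k) by (apply pow_le; left; apply exp_pos).
    assert (0 < exp (-3)) by apply exp_pos. nra.
Qed.

Fixpoint psi_sum (n : nat) (r : R) : R :=
  match n with
  | O => 0
  | S m => psi_sum m r + (psi (half m - r) + psi (half m + r))
  end.

Lemma psi_nonneg (y : R) : 0 <= psi y.
Proof. unfold psi. apply Rmult_le_pos; [apply Rabs_pos | left; apply exp_pos]. Qed.

Lemma psi_sum_incr (m n : nat) (r : R) : (m <= n)%nat -> psi_sum m r <= psi_sum n r.
Proof.
  induction 1; [lra|]. cbn [psi_sum].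
  assert (H1 := psi_nonneg (half m0 - r)). assert (H2 := psi_nonneg (half m0 + r)). lra.
Qed.

(** The centre nearest to [r] is [1/2] or [3/2] according to the case. It contributes at most [1],
    its two neighbours at most [0.45] each, and the others two geometric series:
    [1.9 + 2 * 0.41 / 0.864 < 2.85]. *)
Lemma psi_sum_bound (n : nat) (r : R) : 0 <= r <= 2 -> psi_sum n r <= 285/100.
Proof.
  intros Hr.
  assert (Hq : forall k, 0 <= (136/1000) ^ k) by (intros; apply pow_le; lra).
  destruct (Rle_lt_dec r 1) as [H1|H1].
  - assert (Hm : forall m, psi_sum (S (S m)) r
      <= 19/10 + 41/100 * (2 - (136/1000) ^ m - (136/1000) ^ (S m)) / (864/1000)).
    { induction m as [|m IH].
      - cbn [psi_sum]. unfold half. simpl.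
        assert (A1 := psi_le_1 (0 + 1/2 - r) ltac:(lra)).
        assert (A2 := psi_mid (0 + 1/2 + r) ltac:(nra)).
        assert (A3 := psi_mid (1 + 1/2 - r) ltac:(nra)).
        assert (A4 := psi_geom (1 + 1/2 + r) 0 ltac:(simpl; lra)). simpl in A4. lra.
      - change (psi_sum (S (S (S m))) r) with
          (psi_sum (S (S m)) r + (psi (half (S (S m)) - r) + psi (half (S (S m)) + r))).
        assert (A1 := psi_geom (half (S (S m)) - r) m ltac:(unfold half; rewrite !S_INR; lra)).
        assert (A2 := psi_geom (half (S (S m)) + r) (S m)
          ltac:(unfold half; rewrite !S_INR; lra)).
        simpl pow in *. lra. }
    eapply Rle_trans; [apply (psi_sum_incr n (S (S n))); lia|].
    eapply Rle_trans; [apply Hm|]. assert (H2 := Hq n). assert (H3 := Hq (S n)). lra.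
  - assert (Hm : forall m, psi_sum (S (S (S m))) r
      <= 19/10 + 41/100 * (2 - (136/1000) ^ m - (136/1000) ^ (S (S (S m)))) / (864/1000)).
    { induction m as [|m IH].
      - cbn [psi_sum]. unfold half. simpl.
        assert (A1 := psi_mid (0 + 1/2 - r) ltac:(nra)).
        assert (A2 := psi_le_1 (1 + 1/2 - r) ltac:(lra)).
        assert (A3 := psi_mid (1 + 1 + 1/2 - r) ltac:(nra)).
        assert (A4 := psi_geom (0 + 1/2 + r) 0 ltac:(simpl; lra)).
        assert (A5 := psi_geom (1 + 1/2 + r) 1 ltac:(simpl; lra)).
        assert (A6 := psi_geom (1 + 1 + 1/2 + r) 2 ltac:(simpl; lra)).
        simpl in A4, A5, A6. lra.
      - change (psi_sum (S (S (S (S m)))) r) with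
          (psi_sum (S (S (S m))) r + (psi (half (S (S (S m))) - r) + psi (half (S (S (S m))) + r))).
        assert (A1 := psi_geom (half (S (S (S m))) - r) m ltac:(unfold half; rewrite !S_INR; lra)).
        assert (A2 := psi_geom (half (S (S (S m))) + r) (S (S (S m)))
          ltac:(unfold half; rewrite !S_INR; lra)).
        simpl pow in *. lra. }
    eapply Rle_trans; [apply (psi_sum_incr n (S (S (S n)))); lia|].
    eapply Rle_trans; [apply Hm|]. assert (H2 := Hq n). assert (H3 := Hq (S (S (S n)))). lra.
Qed.

Lemma gker_half (y : R) : gker (1/2) y = exp (- (y * y)).
Proof. unfold gker. f_equal. field. Qed.

Lemma kker1_half_abs (y : R) : Rabs (kker1 (1/2) y) <= 2829/1000 * psi y.
Proof.
  destruct (sqrtT (1/2) ltac:(lra)) as [H1 H2].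
  unfold kker1, psi. rewrite gker_half. unfold Rdiv at 1. rewrite Rabs_mult.
  rewrite (Rabs_mult (1 - _)), (Rabs_pos_eq (exp _)) by (left; apply exp_pos).
  replace (1 - y * y / (1/2)) with (1 - 2 * (y * y)) by field.
  rewrite (Rmult_comm (2829/1000)). apply Rmult_le_compat_l.
  - apply psi_nonneg.
  - assert (7071/10000 <= sqrt (1/2)) by (apply Rnot_lt_le; intros Hl; nra).
    rewrite Rabs_pos_eq by (left; apply Rinv_0_lt_compat; nra).
    replace (2829/1000) with (/ (1000/2829)) by field. apply Rinv_le_contravar; lra.
Qed.

Lemma psi_even (y : R) : psi (- y) = psi y.
Proof. unfold psi. now rewrite Rmult_opp_opp. Qed.

Lemma bil_kker1_half (n : nat) (r : R) :
  0 <= r <= 2 -> Rabs (bil (kker1 (1/2)) n r) <= 8063/1000.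
Proof.
  intros Hr.
  assert (H : Rabs (bil (kker1 (1/2)) n r) <= 2829/1000 * psi_sum n r).
  { induction n as [|n IH]; cbn [bil psi_sum]; [rewrite Rabs_R0; lra|].
    eapply Rle_trans; [apply Rabs_triang|].
    rewrite (Rabs_mult (wt sp n)), unimodular_sp, Rmult_1_l.
    assert (H1 := Rabs_triang (kker1 (1/2) (half n - r)) (kker1 (1/2) (- half n - r))).
    assert (H2 := kker1_half_abs (half n - r)).
    assert (H3 := kker1_half_abs (- half n - r)).
    replace (- half n - r) with (- (half n + r)) in * by ring. rewrite psi_even in H3. lra. }
  assert (H2 := psi_sum_bound n r Hr). lra.
Qed.

(** * Edge behaviour of the bilateral sums and comparison with the cosine *)

Lemma exp_neg_mult (z : R) : 0 <= z -> z * exp (- z) <= 1.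
Proof.
  intros Hz. assert (H := exp_ineq1_le z).
  assert (Hexp : exp z * exp (- z) = 1) by (rewrite <- exp_plus, Rplus_opp_r; apply exp_0).
  assert (0 < exp (- z)) by apply exp_pos. nra.
Qed.

Lemma kker_decay (T : R) : 1/2 <= T -> decay (kker T) 3.
Proof.
  intros HT y. destruct (sqrtT T ltac:(lra)) as [H1 H2].
  assert (7/10 <= sqrt T) by (apply Rnot_lt_le; intros Hl; nra).
  rewrite <- Rabs_mult.
  assert (Hz : 0 <= y * y * / (2 * T)).
  { apply Rmult_le_pos; [apply Rle_0_sqr | left; apply Rinv_0_lt_compat; lra]. }
  replace (kker T y * y) with (2 * / sqrt T * (y * y * / (2 * T) * gker T y))
    by (unfold kker; field; lra).
  assert (He := exp_neg_mult _ Hz). fold (gker T y) in He.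
  assert (Hg : 0 < gker T y) by apply exp_pos.
  assert (Hi : 0 < / sqrt T) by now apply Rinv_0_lt_compat.
  assert (Hi2 : / sqrt T <= / (7/10)) by (apply Rinv_le_contravar; lra).
  replace (/ (7/10)) with (10/7) in Hi2 by field.
  assert (0 <= y * y * / (2 * T) * gker T y) by (apply Rmult_le_pos; lra).
  rewrite Rabs_pos_eq by (apply Rmult_le_pos; lra).
  assert (2 * / sqrt T * (y * y * / (2 * T) * gker T y) <= 20/7 * 1)
    by (apply Rmult_le_compat; lra). lra.
Qed.

Lemma gker_decay (T : R) : 0 < T -> decay (gker T) (T + 1).
Proof.
  intros HT y.
  assert (Hz : 0 <= y * y * / (2 * T)).
  { apply Rmult_le_pos; [apply Rle_0_sqr | left; apply Rinv_0_lt_compat; lra]. }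
  assert (Hg : 0 < gker T y) by apply exp_pos.
  rewrite (Rabs_pos_eq (gker T y)) by lra.
  assert (Hexp : exp (y * y * / (2 * T)) * gker T y = 1)
    by (unfold gker; rewrite <- exp_plus, Rplus_opp_r; apply exp_0).
  assert (H := exp_ineq1_le (y * y * / (2 * T))).
  assert (Hy : Rabs y * Rabs y = y * y) by (unfold Rabs; destruct Rcase_abs; ring).
  assert (Hs : 0 <= (Rabs y - 1) * (Rabs y - 1)) by apply Rle_0_sqr.
  assert (Hyy : y * y * / (2 * T) * (T + 1) = y * y / 2 + y * y * / (2 * T)) by (field; lra).
  enough (Rabs y <= (T + 1) * exp (y * y * / (2 * T))) by nra.
  assert ((T + 1) * (1 + y * y * / (2 * T)) <= (T + 1) * exp (y * y * / (2 * T)))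
    by (apply Rmult_le_compat_l; lra). lra.
Qed.

Lemma kker_odd (T y : R) : kker T (- y) = - kker T y.
Proof. unfold kker, gker. rewrite Rmult_opp_opp. unfold Rdiv. ring. Qed.

(** Pairing opposite centres makes every partial sum of the odd kernel odd, so the side condition at
    [r = 0] is exact; at [r = 2] only an edge term remains. *)
Lemma bil_kker_0 (T : R) (n : nat) : bil (kker T) n 0 = 0.
Proof.
  induction n as [|n IH]; cbn [bil]; [reflexivity|].
  rewrite IH, !Rminus_0_r, kker_odd. ring.
Qed.

(** For the even kernel the values at [-1] and [1] agree, whereas antiperiodicity makes their sum an
    edge term; so the value at [1] tends to [0]. *)
Lemma bil_gker_1 (T : R) (n : nat) : 2 * bil (gker T) n 1 = edge (gker T) n (-1).
Proof.
  rewrite <- bil_shift. replace (-1 + 2) with 1 by ring.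
  assert (H : bil (gker T) n (-1) = bil (gker T) n 1); [|lra].
  induction n as [|n IH]; cbn [bil]; [reflexivity|]. rewrite IH.
  assert (He : forall y, gker T (- y) = gker T y)
    by (intros; unfold gker; now rewrite Rmult_opp_opp).
  replace (half n - -1) with (- (- half n - 1)) by ring.
  replace (- half n - -1) with (- (half n - 1)) by ring. rewrite !He. ring.
Qed.

(** A positive heat solution on [0 <= r <= 2]. The rate [31/20] is just below [PI/2], the slowest
    rate of an antiperiodic solution, so that it stays positive at the ends. *)
Definition comparison (T r : R) : R :=
  824/100 * exp (- (961/800) * (T - 1/2)) * cos (31/20 * (r - 1)).

Lemma comparison_ge (T r : R) : 0 <= r <= 2 ->
  824/10000 * exp (- (961/800) * (T - 1/2)) <= comparison T r.
Proof.
  intros Hr. unfold comparison. assert (H := cos_chord r Hr).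
  assert (Hu : Rabs (r - 1) <= 1) by (apply Rabs_le; lra).
  assert (He := exp_pos (- (961/800) * (T - 1/2))).
  replace (824/10000 * exp (- (961/800) * (T - 1/2)))
    with (824/100 * exp (- (961/800) * (T - 1/2)) * (1/100)) by field.
  apply Rmult_le_compat_l; lra.
Qed.

(** The sum vanishes at [0], is tiny at [2] and has slope at most [8.063], so it lies under a tent.
    The amplitude [8.24] is chosen so that [8.24 * 0.979] exceeds this slope, and [cos_chord] does
    the rest. *)
Lemma bil_kker_init (n : nat) (r : R) :
  Rabs (bil (kker (1/2)) n 2) <= 1/100 -> 0 <= r <= 2 ->
  Rabs (bil (kker (1/2)) n r) <= comparison (1/2) r.
Proof.
  intros H2 Hr. unfold comparison. rewrite Rminus_diag, Rmult_0_r, exp_0.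
  assert (Hc := cos_chord r Hr).
  assert (Hl : forall u v, 0 <= u <= v -> v <= 2 ->
    Rabs (bil (kker (1/2)) n v - bil (kker (1/2)) n u) <= 8063/1000 * (v - u)).
  { intros u v Huv Hv. destruct (Req_dec u v) as [->|Hne].
    { rewrite Rminus_diag, Rabs_R0. lra. }
    destruct (MVT_cor2 (bil (kker (1/2)) n) (fun r => - bil (kker1 (1/2)) n r) u v ltac:(lra))
      as (c & Hc1 & Hc2).
    { intros c _. apply is_derive_Reals, bil_derive. intros y. apply kker_derive. lra. }
    rewrite Hc1, Rabs_mult, Rabs_Ropp, (Rabs_pos_eq (v - u)) by lra.
    apply Rmult_le_compat_r; [lra|]. apply bil_kker1_half. lra. }
  destruct (Rle_lt_dec r 1) as [H1|H1].
  - assert (H := Hl 0 r ltac:(lra) ltac:(lra)). rewrite bil_kker_0, Rminus_0_r in H.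
    rewrite Rabs_left1 in Hc by lra. lra.
  - assert (H := Hl r 2 ltac:(lra) ltac:(lra)).
    rewrite Rabs_pos_eq in Hc by lra.
    apply Rabs_le_between in H. apply Rabs_le_between in H2. apply Rabs_le. lra.
Qed.

(** The edge term at [r = 2] must stay below a comparison function that decays in [T]. Its size [e]
    is therefore fixed by the final time [T1], and [N] depends on [T1]. *)
Lemma bil_kker_bound (T1 : R) : 1/2 <= T1 ->
  exists N, forall n, (N <= n)%nat -> forall T r, 1/2 <= T <= T1 -> 0 <= r <= 2 ->
    Rabs (bil (kker T) n r) <= comparison T r.
Proof.
  intros HT1.
  set (e := 824/100000 * exp (- (961/800) * (T1 - 1/2))).
  assert (He : 0 < e) by (unfold e; assert (H := exp_pos (- (961/800) * (T1 - 1/2))); lra).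
  destruct (edge_small 3 0 e ltac:(lra) He) as [N HN].
  exists N. intros n Hn T r HT Hr.
  assert (H2 : forall T, 1/2 <= T <= T1 -> Rabs (bil (kker T) n 2) <= e).
  { intros T' HT'. assert (Hs := bil_shift (kker T') n 0).
    rewrite bil_kker_0, Rplus_0_l, Rplus_0_r in Hs. rewrite Hs.
    apply HN; [apply kker_decay; lra | rewrite Rabs_R0; lra | exact Hn]. }
  assert (He2 : forall T, 1/2 <= T <= T1 -> e <= 824/10000 * exp (- (961/800) * (T - 1/2))).
  { intros T' HT'. unfold e.
    assert (exp (- (961/800) * (T1 - 1/2)) <= exp (- (961/800) * (T' - 1/2)))
      by (apply exp_le; lra).
    assert (Hx := exp_pos (- (961/800) * (T1 - 1/2))). lra. }
  assert (He3 : e <= 1/100).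
  { unfold e.
    assert (exp (- (961/800) * (T1 - 1/2)) <= exp 0) by (apply exp_le; lra).
    rewrite exp_0 in *. lra. }
  assert (Hmain : forall sg, Rabs sg = 1 ->
    0 <= comparison T r + sg * bil (kker T) n r).
  { intros sg Hsg.
    assert (Hle : forall u v, Rabs u <= v -> 0 <= v + sg * u).
    { intros u v Huv. assert (H : Rabs (sg * u) <= v) by (rewrite Rabs_mult, Hsg; lra).
      apply Rabs_le_between in H. lra. }
    apply (heat_min_principle
      (fun T r => comparison T r + sg * bil (kker T) n r)
      (fun T r => - (824/100 * (31/20)) * exp (- (961/800) * (T - 1/2)) * sin (31/20 * (r - 1))
                  + sg * - bil (kker1 T) n r)
      (fun T r => - (961/400) * comparison T r + sg * bil (kker2 T) n r)
      (fun T r => - (961/800) * comparison T r + sg * (1/2 * bil (kker2 T) n r))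
      (1/2) 0 (1/2) T1 0 2 0); try lra.
    - intros t s Ht Hs. apply continuity_2d_pt_plus.
      + unfold comparison. apply continuity_2d_pt_mult.
        * apply continuity_2d_pt_mult; [apply continuity_2d_pt_const|].
          apply (continuity_1d_2d_pt_comp (fun T => exp (- (961/800) * (T - 1/2))) (fun T _ => T));
            [|apply continuity_2d_pt_id1].
          apply derivable_continuous_pt. eexists. apply is_derive_Reals. auto_derive; trivial.
        * apply (continuity_1d_2d_pt_comp (fun r => cos (31/20 * (r - 1))) (fun _ r => r));
            [|apply continuity_2d_pt_id2].
          apply derivable_continuous_pt. eexists. apply is_derive_Reals. auto_derive; trivial.
      + apply continuity_2d_pt_mult; [apply continuity_2d_pt_const|].
        apply bil_kker_continuity_2d. lra.
    - intros t s Ht Hs. refine (conj _ (conj _ (conj _ _))).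
      + apply (is_derive_plus (comparison t)).
        * unfold comparison. auto_derive; [trivial | unfold Rminus; field].
        * apply (is_derive_scal (bil (kker t) n)), bil_derive.
          intros y. apply kker_derive. lra.
      + apply (is_derive_plus (fun r => - (824/100 * (31/20)) * exp (- (961/800) * (t - 1/2))
                                        * sin (31/20 * (r - 1)))).
        * unfold comparison. auto_derive; [trivial | unfold Rminus; field].
        * apply (is_derive_scal (fun r => - bil (kker1 t) n r)).
          replace (bil (kker2 t) n s) with (- - bil (kker2 t) n s) by ring.
          apply (is_derive_opp (bil (kker1 t) n)), bil_derive.
          intros y. apply kker1_derive. lra.
      + apply (is_derive_plus (fun T => comparison T s)).
        * unfold comparison. auto_derive; [trivial | unfold Rminus; field].
        * apply (is_derive_scal (fun T => bil (kker T) n s)), bil_derive_T. lra.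
      + field.
    - intros s Hs. apply Hle, bil_kker_init; [|exact Hs].
      eapply Rle_trans; [apply H2; lra | exact He3].
    - intros t Ht. split; apply Hle.
      + rewrite bil_kker_0, Rabs_R0. eapply Rle_trans; [|apply comparison_ge; lra].
        specialize (He2 t Ht). lra.
      + eapply Rle_trans; [apply H2; exact Ht|].
        eapply Rle_trans; [apply He2; exact Ht | apply comparison_ge; lra]. }
  assert (Hp := Hmain 1 Rabs_R1).
  assert (Hm := Hmain (-1) ltac:(rewrite Rabs_left; lra)). apply Rabs_le. lra.
Qed.

Lemma bil_kker_ev (T r : R) : 1/2 <= T -> 0 <= r ->
  ev_bound (fun n => bil (kker T) n r) (824/100 * exp (- (961/800) * (T - 1/2))).
Proof.
  intros HT. revert r. apply (bil_extend _ 3); [now apply kker_decay|].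
  intros r Hr e He. destruct (bil_kker_bound T HT) as [N HN].
  exists N. intros n Hn. specialize (HN n Hn T r ltac:(lra) Hr).
  unfold comparison in HN. assert (H := COS_bound (31/20 * (r - 1))).
  assert (Hx := exp_pos (- (961/800) * (T - 1/2))). nra.
Qed.

(** The derivative in [r] is [sqrt T] times the sum of [kker], already bounded. Every point of
    [[0, 2]] is within distance [1] of [r = 1], where the sum tends to [0], so the mean value
    theorem suffices. *)
Lemma bil_gker_ev (T r : R) : 1/2 <= T -> 0 <= r ->
  ev_bound (fun n => bil (gker T) n r) (sqrt T * (824/100 * exp (- (961/800) * (T - 1/2)))).
Proof.
  intros HT. revert r. apply (bil_extend _ (T + 1)); [apply gker_decay; lra|].
  intros r Hr e He. destruct (bil_kker_bound T HT) as [N1 H1].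
  destruct (edge_small (T + 1) 1 e ltac:(lra) He) as [N2 H2].
  exists (N1 + N2)%nat. intros n Hn.
  destruct (sqrtT T ltac:(lra)) as [Hq1 Hq2].
  set (B := 824/100 * exp (- (961/800) * (T - 1/2))).
  assert (HB : 0 < B) by (unfold B; assert (Hx := exp_pos (- (961/800) * (T - 1/2))); lra).
  assert (Hk : forall r, 0 <= r <= 2 -> Rabs (sqrt T * bil (kker T) n r) <= sqrt T * B).
  { intros r' Hr'. rewrite Rabs_mult, (Rabs_pos_eq (sqrt T)) by lra.
    apply Rmult_le_compat_l; [lra|].
    specialize (H1 n ltac:(lia) T r' ltac:(lra) Hr').
    unfold comparison in H1. fold B in H1. assert (H := COS_bound (31/20 * (r' - 1))). nra. }
  assert (Hd : forall r, is_derive (bil (gker T) n) r (sqrt T * bil (kker T) n r)).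
  { intros r'. replace (sqrt T * bil (kker T) n r')
      with (- bil (fun y => - y / T * gker T y) n r').
    - apply bil_derive. intros y. apply gker_derive. lra.
    - clear - Hq1 Hq2. induction n as [|n IH]; cbn [bil]; [ring|].
      rewrite Ropp_plus_distr, IH.
      assert (Hy : forall y, - y / T * gker T y = - (sqrt T * kker T y)).
      { intros y. unfold kker. set (q := sqrt T) in *. rewrite <- Hq2. field. lra. }
      rewrite !Hy. ring. }
  specialize (H2 (gker T) n (-1) (gker_decay T ltac:(lra)) ltac:(rewrite Rabs_left; lra) ltac:(lia)).
  rewrite <- bil_gker_1 in H2.
  assert (H0 : Rabs (bil (gker T) n 1) <= e / 2).
  { rewrite Rabs_mult, (Rabs_pos_eq 2) in H2 by lra. lra. }
  assert (Hl : forall u v, 0 <= u < v -> v <= 2 -> v - u <= 1 ->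
    Rabs (bil (gker T) n v - bil (gker T) n u) <= sqrt T * B).
  { intros u v Huv Hv Hvu.
    destruct (MVT_cor2 (bil (gker T) n) (fun r => sqrt T * bil (kker T) n r) u v ltac:(lra))
      as (c & Hc1 & Hc2).
    { intros c _. apply is_derive_Reals, Hd. }
    rewrite Hc1, Rabs_mult, (Rabs_pos_eq (v - u)) by lra.
    assert (H := Hk c ltac:(lra)). assert (H' := Rabs_pos (sqrt T * bil (kker T) n c)). nra. }
  apply Rabs_le_between in H0.
  assert (0 < sqrt T * B) by (apply Rmult_lt_0_compat; lra).
  destruct (Rtotal_order r 1) as [Hr1|[->|Hr1]].
  - assert (H' := Hl r 1 ltac:(lra) ltac:(lra) ltac:(lra)).
    apply Rabs_le_between in H'. apply Rabs_le. lra.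
  - apply Rabs_le. lra.
  - assert (H' := Hl 1 r ltac:(lra) ltac:(lra) ltac:(lra)).
    apply Rabs_le_between in H'. apply Rabs_le. lra.
Qed.

(** With [p = exp (- 1/T)], [x = exp s] and [r = s T], completing the square turns the terms of
    [theta (- p) x + theta (- p) (/ x) / x] into Gaussians in [r], up to this factor. *)
Definition modulus (T s : R) : R := exp (/ (8 * T) - s / 2 + s * s * T / 2).

Lemma mono_gker (T s : R) (j : nat) : 0 < T ->
  mono (exp (- / T)) (exp s) j = modulus T s * gker T (half j - s * T).
Proof.
  intros HT. unfold mono, modulus, gker, half. rewrite <- !exp_mult_nat, <- !exp_plus. f_equal.
  replace (INR (tri j)) with ((INR j * INR j + INR j) / 2) by (rewrite <- INR_tri; field).
  field. lra.
Qed.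

Lemma mono_inv_gker (T s : R) (j : nat) : 0 < T ->
  / exp s * mono (exp (- / T)) (/ exp s) j = modulus T s * gker T (- half j - s * T).
Proof.
  intros HT. rewrite <- exp_Ropp. unfold mono, modulus, gker, half.
  rewrite <- !exp_mult_nat, <- !exp_plus. f_equal.
  replace (INR (tri j)) with ((INR j * INR j + INR j) / 2) by (rewrite <- INR_tri; field).
  field. lra.
Qed.

Lemma psum_bil (T s : R) (n : nat) : 0 < T ->
  psum sp n (exp (- / T)) (exp s) + / exp s * psum sp n (exp (- / T)) (/ exp s)
  = modulus T s * bil (gker T) n (s * T).
Proof.
  intros HT. induction n as [|n IH]; cbn [psum bil]; [ring|].
  rewrite !Rmult_plus_distr_l, <- IH.
  assert (H1 := mono_gker T s n HT). assert (H2 := mono_inv_gker T s n HT).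
  replace (modulus T s * (wt sp n * gker T (half n - s * T)))
    with (wt sp n * (modulus T s * gker T (half n - s * T))) by ring.
  replace (modulus T s * (wt sp n * gker T (- half n - s * T)))
    with (wt sp n * (modulus T s * gker T (- half n - s * T))) by ring.
  rewrite <- H1, <- H2. ring.
Qed.

(** The weight [j] splits as [(half j - s T) + (s T - 1/2)], and [- (j + 1)] likewise with
    [- half j]; the first summand turns [gker] into [kker]. *)
Lemma psum_bil_derive (T s : R) (n : nat) : 0 < T ->
  psum (jw sp) n (exp (- / T)) (exp s) - / exp s * psum (j1w sp) n (exp (- / T)) (/ exp s)
  = modulus T s * ((s * T - 1/2) * bil (gker T) n (s * T)
                   + T * sqrt T * bil (kker T) n (s * T)).
Proof.
  intros HT. destruct (sqrtT T HT) as [Hq _].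
  assert (Hk : forall y, T * sqrt T * kker T y = y * gker T y)
    by (intros; unfold kker; field; lra).
  induction n as [|n IH]; cbn [psum bil]; [ring|].
  rewrite wt_jw, wt_j1w.
  assert (H1 := mono_gker T s n HT). assert (H2 := mono_inv_gker T s n HT).
  replace (modulus T s *
    ((s * T - 1/2) * (bil (gker T) n (s * T) + wt sp n * (gker T (half n - s * T) + gker T (- half n - s * T))) +
     T * sqrt T * (bil (kker T) n (s * T) + wt sp n * (kker T (half n - s * T) + kker T (- half n - s * T)))))
  with (modulus T s * ((s * T - 1/2) * bil (gker T) n (s * T) + T * sqrt T * bil (kker T) n (s * T))
    + wt sp n * ((s * T - 1/2) * (modulus T s * gker T (half n - s * T))
                 + modulus T s * (T * sqrt T * kker T (half n - s * T)))
    + wt sp n * ((s * T - 1/2) * (modulus T s * gker T (- half n - s * T))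
                 + modulus T s * (T * sqrt T * kker T (- half n - s * T)))) by ring.
  rewrite <- IH, !Hk.
  replace (modulus T s * ((half n - s * T) * gker T (half n - s * T)))
    with ((half n - s * T) * (modulus T s * gker T (half n - s * T))) by ring.
  replace (modulus T s * ((- half n - s * T) * gker T (- half n - s * T)))
    with ((- half n - s * T) * (modulus T s * gker T (- half n - s * T))) by ring.
  rewrite <- H1, <- H2. unfold half. field. apply Rgt_not_eq, exp_pos.
Qed.

(** * Explicit bounds for theta near [p = 1] *)

Lemma ev_bound_lim (u : nat -> R) (l M : R) : is_lim_seq u l -> ev_bound u M -> Rabs l <= M.
Proof.
  intros Hl Hb. apply Rnot_lt_le. intros Hlt.
  destruct (Hb ((Rabs l - M) / 2) ltac:(lra)) as [N HN].
  assert (H : Rabs l <= M + (Rabs l - M) / 2); [|lra].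
  apply (is_lim_seq_le_loc (fun n => Rabs (u n)) (fun _ => M + (Rabs l - M) / 2)
           (Rabs l) (M + (Rabs l - M) / 2));
    [exists N; exact HN | apply (is_lim_seq_abs u l Hl) | apply is_lim_seq_const].
Qed.

Lemma ev_bound_scal (u : nat -> R) (c M : R) :
  0 < c -> ev_bound u M -> ev_bound (fun n => c * u n) (c * M).
Proof.
  intros Hc Hu e He. destruct (Hu (e / c)) as [N HN]; [now apply Rdiv_lt_0_compat|].
  exists N. intros n Hn. rewrite Rabs_mult, (Rabs_pos_eq c) by lra.
  specialize (HN n Hn). replace (c * M + e) with (c * (M + e / c)) by (field; lra).
  apply Rmult_le_compat_l; lra.
Qed.

Lemma ev_bound_plus (u v : nat -> R) (M L : R) :
  ev_bound u M -> ev_bound v L -> ev_bound (fun n => u n + v n) (M + L).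
Proof.
  intros Hu Hv e He.
  destruct (Hu (e / 2) ltac:(lra)) as [N1 H1]. destruct (Hv (e / 2) ltac:(lra)) as [N2 H2].
  exists (N1 + N2)%nat. intros n Hn.
  specialize (H1 n ltac:(lia)). specialize (H2 n ltac:(lia)).
  eapply Rle_trans; [apply Rabs_triang | lra].
Qed.

Definition remainder (T s : R) : R :=
  modulus T s * (sqrt T * (824/100 * exp (- (961/800) * (T - 1/2)))).

Lemma exp_neg_lt_1 (T : R) : 0 < T -> 0 <= exp (- / T) < 1.
Proof.
  intros HT. split; [left; apply exp_pos|]. rewrite <- exp_0. apply exp_increasing.
  assert (0 < / T) by now apply Rinv_0_lt_compat. lra.
Qed.

Lemma star_bound (T s : R) : 1/2 <= T -> 0 <= s ->
  Rabs (U sp (exp (- / T)) (exp s) + / exp s * U sp (exp (- / T)) (/ exp s)) <= remainder T s.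
Proof.
  intros HT Hs. assert (Hp := exp_neg_lt_1 T ltac:(lra)).
  assert (Hx := exp_pos s). assert (Hx' : 0 < / exp s) by now apply Rinv_0_lt_compat.
  apply (ev_bound_lim (fun n => modulus T s * bil (gker T) n (s * T))).
  - apply (is_lim_seq_ext (fun n => psum sp n (exp (- / T)) (exp s)
             + / exp s * psum sp n (exp (- / T)) (/ exp s))).
    + intros n. apply psum_bil. lra.
    + apply is_lim_seq_plus'.
      * apply U_lim; [apply tame_sp | exact Hp | lra].
      * apply (is_lim_seq_scal_l (fun n => psum sp n (exp (- / T)) (/ exp s)) (/ exp s)
          (Finite (U sp (exp (- / T)) (/ exp s)))).
        apply U_lim; [apply tame_sp | exact Hp | lra].
  - apply ev_bound_scal; [apply exp_pos|]. apply bil_gker_ev; [exact HT | nra].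
Qed.

Lemma star_derive_bound (T s : R) : 1/2 <= T -> 0 < s * T - 1/2 ->
  Rabs (U (jw sp) (exp (- / T)) (exp s) - / exp s * U (j1w sp) (exp (- / T)) (/ exp s))
  <= (s * T - 1/2 + T) * remainder T s.
Proof.
  intros HT Hs. assert (Hp := exp_neg_lt_1 T ltac:(lra)).
  assert (Hx := exp_pos s). assert (Hx' : 0 < / exp s) by now apply Rinv_0_lt_compat.
  destruct (sqrtT T ltac:(lra)) as [Hq _].
  apply (ev_bound_lim (fun n => modulus T s * ((s * T - 1/2) * bil (gker T) n (s * T)
                   + T * sqrt T * bil (kker T) n (s * T)))).
  - apply (is_lim_seq_ext (fun n => psum (jw sp) n (exp (- / T)) (exp s)
             - / exp s * psum (j1w sp) n (exp (- / T)) (/ exp s))).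
    + intros n. apply psum_bil_derive. lra.
    + apply is_lim_seq_minus'.
      * apply U_lim; [apply tame_jw_sp | exact Hp | lra].
      * apply (is_lim_seq_scal_l (fun n => psum (j1w sp) n (exp (- / T)) (/ exp s)) (/ exp s)
          (Finite (U (j1w sp) (exp (- / T)) (/ exp s)))).
        apply U_lim; [apply tame_j1w, unimodular_sp | exact Hp | lra].
  - unfold remainder.
    set (B := 824/100 * exp (- (961/800) * (T - 1/2))).
    replace ((s * T - 1/2 + T) * (modulus T s * (sqrt T * B)))
      with (modulus T s * ((s * T - 1/2) * (sqrt T * B) + T * sqrt T * B)) by ring.
    apply ev_bound_scal; [apply exp_pos|].
    assert (0 <= s * T) by lra.
    apply ev_bound_plus; apply ev_bound_scal; try lra.
    + now apply bil_gker_ev.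
    + apply Rmult_lt_0_compat; lra.
    + now apply bil_kker_ev.
Qed.

(** The powers of [T] are majorized by exponentials that are exact ([sqrt T] up to rounding) at
    [T = 10]. Because [s^2 <= 2], the total exponent then decreases in [T], so [T = 10] is the worst
    case; [261] exceeds [10 * sqrt 10 * 8.24]. From [s >= 1/20] on, [5 s^2 - s / 2] increases, which
    allows [S] in place of [s]. *)
Lemma remainder_bound (T s S : R) : 10 <= T -> 1/20 <= s <= S -> S * S <= 2 ->
  T * remainder T s <= 261 * exp (5 * (S * S) - S / 2 - 1139/100).
Proof.
  intros HT Hs HS.
  assert (Hq : sqrt T <= 31623/10000 * exp ((T - 10) / 20)).
  { destruct (sqrtT T ltac:(lra)) as [H1 H2].
    assert (H3 := exp_ineq1_le ((T - 10) / 20)).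
    assert (Hsq : 0 <= (sqrt T - 31623/10000) * (sqrt T - 31623/10000)) by apply Rle_0_sqr.
    apply Rle_trans with (31623/10000 * (1 + (T - 10) / 20)); [|lra]. nra. }
  assert (HTe : T <= 10 * exp ((T - 10) / 10)).
  { assert (H3 := exp_ineq1_le ((T - 10) / 10)). lra. }
  assert (Hi : / (8 * T) <= 1/80).
  { replace (1/80) with (/ 80) by field. apply Rinv_le_contravar; lra. }
  unfold remainder, modulus.
  set (e1 := exp (/ (8 * T) - s / 2 + s * s * T / 2)).
  set (e2 := exp (- (961/800) * (T - 1/2))).
  assert (He1 : 0 < e1) by apply exp_pos. assert (He2 : 0 < e2) by apply exp_pos.
  assert (Hsq0 : 0 <= sqrt T) by apply sqrt_pos.
  apply Rle_trans with (10 * exp ((T - 10) / 10)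
     * (e1 * (31623/10000 * exp ((T - 10) / 20) * (824/100 * e2)))).
  { apply Rmult_le_compat; try lra.
    - apply Rmult_le_pos; [lra|]. apply Rmult_le_pos; lra.
    - apply Rmult_le_compat_l; [lra|]. apply Rmult_le_compat_r; lra. }
  replace (10 * exp ((T - 10) / 10) * (e1 * (31623/10000 * exp ((T - 10) / 20) * (824/100 * e2))))
    with (10 * (31623/10000) * (824/100)
          * exp ((T - 10) / 10 + (/ (8 * T) - s / 2 + s * s * T / 2)
                 + (T - 10) / 20 + - (961/800) * (T - 1/2)))
    by (unfold e1, e2; generalize (/ (8 * T) - s / 2 + s * s * T / 2) (- (961/800) * (T - 1/2))
          ((T - 10) / 10) ((T - 10) / 20); intros; rewrite !exp_plus; ring).
  apply Rmult_le_compat; try lra; [left; apply exp_pos|].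
  apply exp_le.
  assert (H1 : s * s <= S * S) by nra.
  assert (H2 : s * s * T / 2 <= S * S * T / 2) by nra.
  assert (H2' : 5 * (s * s) - s / 2 <= 5 * (S * S) - S / 2) by nra.
  assert (H3 : (s * s / 2 - 1) * (T - 10) <= 0) by nra.
  nra.
Qed.

Lemma near_one (p : R) : 181/200 <= p < 1 -> exists T, 10 <= T /\ p = exp (- / T).
Proof.
  intros Hp. exists (- / ln p).
  assert (Hl : ln p < 0) by (rewrite <- ln_1; apply ln_increasing; lra).
  assert (Hl2 : - ln p <= 1/10).
  { assert (H := exp_lower3 (1/10) ltac:(lra)).
    rewrite <- ln_Rinv by lra. rewrite <- (ln_exp (1/10)). apply ln_le.
    - apply Rinv_0_lt_compat; lra.
    - eapply Rle_trans; [|exact H]. replace (1 + 1/10 + (1/10)^2/2 + (1/10)^3/6)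
        with (/ (6000/6631)) by field. apply Rinv_le_contravar; lra. }
  split.
  - replace (- / ln p) with (/ (- ln p)) by (field; lra).
    replace 10 with (/ (1/10)) by field. apply Rinv_le_contravar; lra.
  - replace (- / - / ln p) with (ln p) by (field; lra). now rewrite exp_ln by lra.
Qed.

Lemma star_small (p x S : R) : 181/200 <= p < 1 -> 6/5 <= x -> x <= exp S -> S * S <= 2 ->
  0 <= S ->
  Rabs (U sp p x + / x * U sp p (/ x)) <= 261/10 * exp (5 * (S * S) - S / 2 - 1139/100) /\
  Rabs (U (jw sp) p x - / x * U (j1w sp) p (/ x))
    <= 261 * (S + 1) * exp (5 * (S * S) - S / 2 - 1139/100).
Proof.
  intros Hp Hx HxS HS HS0.
  destruct (near_one p Hp) as (T & HT & ->).
  assert (Hs1 : 1/10 <= ln x).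
  { rewrite <- (ln_exp (1/10)). apply ln_le; [apply exp_pos|].
    assert (H : exp (1/10) <= / (9/10)); [|lra].
    replace (exp (1/10)) with (/ exp (- (1/10))) by (rewrite <- exp_Ropp; f_equal; lra).
    apply Rinv_le_contravar; [lra|]. assert (H := exp_ineq1_le (- (1/10))). lra. }
  assert (Hs2 : ln x <= S) by (rewrite <- (ln_exp S); apply ln_le; lra).
  assert (Hex : exp (ln x) = x) by (apply exp_ln; lra).
  set (s := ln x) in *. rewrite <- Hex.
  assert (Hr := remainder_bound T s S HT ltac:(lra) HS).
  set (X := exp (5 * (S * S) - S / 2 - 1139/100)) in *.
  assert (Hr0 : 0 <= remainder T s).
  { unfold remainder, modulus. apply Rmult_le_pos; [left; apply exp_pos|].
    apply Rmult_le_pos; [apply sqrt_pos|].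
    assert (H := exp_pos (- (961/800) * (T - 1/2))). lra. }
  split.
  - eapply Rle_trans; [apply star_bound; lra|]. nra.
  - eapply Rle_trans; [apply star_derive_bound; nra|].
    assert (s * T * remainder T s <= S * (261 * X)).
    { replace (s * T * remainder T s) with (s * (T * remainder T s)) by ring.
      apply Rmult_le_compat; nra. }
    nra.
Qed.

(** The term [theta (q, 1/x) / x] is at least [0.59 * 5/16], about [0.184], while the bilateral sum
    is below [0.149]. The value [1.166] is slightly above [ln 3.2]. *)
Lemma asym_sn_32 (p : R) : 181/200 <= p < 1 -> 151/10000 <= U sn p (16/5).
Proof.
  intros Hp. rewrite U_sn.
  destruct (star_small p (16/5) (1166/1000) Hp) as [H _]; try lra.
  { eapply Rle_trans; [|apply (exp_lower _ 8 (1166/8000)); [lra | simpl; lra]]. simpl. lra. }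
  assert (He : exp (5 * (1166/1000 * (1166/1000)) - 1166/1000 / 2 - 1139/100) <= 57/10000).
  { apply Rle_trans with (exp (- (5175/1000))); [apply exp_le; lra|].
    rewrite exp_Ropp. replace (57/10000) with (/ (10000/57)) by field.
    apply Rinv_le_contravar; [lra|].
    eapply Rle_trans; [|apply (exp_lower _ 20 (5175/20000)); [lra | simpl; lra]]. simpl. lra. }
  replace (/ (16/5)) with (5/16) in H by field.
  assert (Hi := inv_32 p ltac:(lra)). apply Rabs_le_between in H. lra.
Qed.

Lemma asym_15_exp : 3/2 <= exp (41/100) /\
  exp (5 * (41/100 * (41/100)) - 41/100 / 2 - 1139/100) <= 1/10000.
Proof.
  split.
  - eapply Rle_trans; [|apply exp_lower3; lra]. lra.
  - apply Rle_trans with (exp (- (10))); [apply exp_le; lra|].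
    rewrite exp_Ropp. replace (1/10000) with (/ 10000) by field.
    apply Rinv_le_contravar; [lra|].
    eapply Rle_trans; [|apply (exp_lower _ 20 (1/2)); [lra | simpl; lra]]. simpl. lra.
Qed.

Lemma asym_sn_15 (p : R) : 181/200 <= p < 1 -> 1/100 <= U sn p (3/2).
Proof.
  intros Hp. rewrite U_sn. destruct asym_15_exp as [H1 H2].
  destruct (star_small p (3/2) (41/100) Hp) as [H _]; try lra.
  replace (/ (3/2)) with (2/3) in H by field.
  assert (Hi := inv_15 p ltac:(lra)). apply Rabs_le_between in H. lra.
Qed.

Lemma asym_jsn_15 (p : R) : 181/200 <= p < 1 -> 1/100 <= U (jw sn) p (3/2).
Proof.
  intros Hp. destruct asym_15_exp as [H1 H2].
  destruct (star_small p (3/2) (41/100) Hp) as [_ H]; try lra.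
  replace (/ (3/2)) with (2/3) in H by field.
  assert (Hi := inv_15d p ltac:(lra)).
  rewrite (U_opp (j1w sp)) in Hi by (intros; rewrite !wt_j1w, wt_sn; ring).
  rewrite (U_opp (jw sp)) by (intros; rewrite !wt_jw, wt_sn; ring).
  apply Rabs_le_between in H. lra.
Qed.

(* The functional equation [theta q y = 1 + q y theta q (q y)] at [y = t / p]. *)
Lemma psum_functional (n : nat) (p t : R) : 0 < p ->
  psum sp (S n) p (t / p) = 1 - t * psum sm n p t.
Proof.
  intros Hp. induction n as [|n IH].
  - cbn [psum]. rewrite wt_sp. unfold mono. change (tri 0) with 0%nat. simpl. ring.
  - change (psum sp (S (S n)) p (t / p)) with
      (psum sp (S n) p (t / p) + wt sp (S n) * mono p (t / p) (S n)).
    rewrite IH. cbn [psum]. rewrite wt_sp, wt_sm. unfold mono.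
    rewrite tri_S. unfold Rdiv. rewrite Rpow_mult_distr, pow_inv, !pow_add.
    simpl. field. split; [apply pow_nonzero|]; lra.
Qed.

Lemma U_functional (p t : R) : 0 < p < 1 -> 0 <= t -> U sp p (t / p) = 1 - t * U sm p t.
Proof.
  intros Hp Ht.
  assert (H1 : is_lim_seq (fun n => psum sp (S n) p (t / p)) (U sp p (t / p))).
  { apply (is_lim_seq_incr_1 (fun n => psum sp n p (t / p))).
    apply U_lim; [apply tame_sp | lra | apply Rdiv_le_0_compat; lra]. }
  assert (H2 : is_lim_seq (fun n => psum sp (S n) p (t / p)) (1 - t * U sm p t)).
  { apply (is_lim_seq_ext (fun n => 1 - t * psum sm n p t)).
    - intros n. symmetry. apply psum_functional. lra.
    - apply is_lim_seq_minus'; [apply is_lim_seq_const|].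
      apply (is_lim_seq_scal_l (fun n => psum sm n p t) t (Finite (U sm p t))).
      apply U_lim; [apply tame_sm | lra | exact Ht]. }
  apply is_lim_seq_unique in H1. apply is_lim_seq_unique in H2.
  rewrite H1 in H2. now injection H2.
Qed.

Lemma U_sp_small (p x : R) : 0 <= p < 1 -> 0 <= x <= 1/3 -> 0 <= U sp p x.
Proof.
  intros Hp Hx. numeric U_ge_p sp 12%nat 0%Z 0%Z 16777216%Z 0%Z 5704254%Z tame_sp.
Qed.

(** By the functional equation it suffices that theta at [x = 3.1 / p] stays clearly below [1]. The
    bilateral sum there is at most [26.1 / 50], and the subtracted term [theta (q, 1/x) / x] is
    nonnegative. *)
Lemma asym_sm_31 (p : R) : 181/200 <= p < 1 -> 1/200 <= U sm p (31/10).
Proof.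
  intros Hp. assert (Hf := U_functional p (31/10) ltac:(lra) ltac:(lra)).
  set (x := 31/10 / p) in *.
  assert (Hx : 31/10 <= x <= 343/100).
  { assert (Hxp : x * p = 31/10) by (unfold x; field; lra).
    split; apply (Rmult_le_reg_r p); lra. }
  destruct (star_small p x (1235/1000) Hp) as [H _]; try lra.
  { apply Rle_trans with (343/100); [lra|].
    eapply Rle_trans; [|apply (exp_lower _ 8 (1235/8000)); [lra | simpl; lra]]. simpl. lra. }
  assert (He : exp (5 * (1235/1000 * (1235/1000)) - 1235/1000 / 2 - 1139/100) <= 1/50).
  { apply Rle_trans with (exp (- (438/100))); [apply exp_le; lra|].
    rewrite exp_Ropp. replace (1/50) with (/ 50) by field.
    apply Rinv_le_contravar; [lra|].
    eapply Rle_trans; [|apply (exp_lower _ 20 (438/2000)); [lra | simpl; lra]]. simpl. lra. }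
  assert (Hxi : 0 <= / x <= 1/3).
  { split; [left; apply Rinv_0_lt_compat; lra|].
    replace (1/3) with (/ 3) by field. apply Rinv_le_contravar; lra. }
  assert (Hi := U_sp_small p (/ x) ltac:(lra) Hxi).
  assert (0 <= / x * U sp p (/ x)) by (apply Rmult_le_pos; lra).
  apply Rabs_le_between in H. lra.
Qed.

(** * Location of the zeros *)

(** The logarithmic coordinates of the minimum principle exclude [p = 0] and [x = 0]. Crude bounds
    near both axes fill the gap and also supply starting and side values. *)
Lemma sm_small_x (p x : R) : 0 <= p < 1 -> 0 <= x <= 1/10 -> 1/2 <= U sm p x.
Proof.
  intros Hp Hx.
  numeric U_ge_p sm 12%nat 8388608%Z 0%Z 16777216%Z 0%Z 1677722%Z tame_sm.
Qed.

Lemma sm_small_p (p x : R) : 0 <= p <= 1/10 -> 0 <= x <= 12/5 -> 1/2 <= U sm p x.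
Proof.
  intros Hp Hx.
  numeric U_ge_p sm 12%nat 8388608%Z 0%Z 1677722%Z 0%Z 40265319%Z tame_sm.
Qed.

(** No positive constant can bound [x d/dx theta] away from [0] as [x] tends to [0], so the bound
    follows the leading term [p x]: the next term has the same sign, and the tail is at most
    [16 * mono p x 3]. *)
Lemma jsn_small (p x : R) : 0 < p < 1 -> 0 < x -> x <= 1/10 \/ p <= 1/10 /\ x <= 12/5 ->
  p * x / 2 <= U (jw sn) p x.
Proof.
  intros Hp Hx Hs. apply U_ge with 3%nat; [apply tame_jw_sn | lra | lra |].
  intros k Hk.
  assert (Hp2 : p * p <= p) by nra. assert (Hp3 : p * p * p <= p * p) by nra.
  assert (Hpp : 0 <= p * p) by nra. assert (Hppp : 0 <= p * p * p) by nra.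
  assert (Hc : p * p * p * x <= 1/10).
  { destruct Hs as [Hs|[Hs1 Hs2]]; [nra|].
    assert (p * p * p <= 1/100 * (1/10)) by (apply Rmult_le_compat; nra). nra. }
  assert (H := psum_tail (jw sn) 3 k p x tame_jw_sn ltac:(lra) ltac:(lra)
    ltac:(simpl; lra) Hk).
  assert (E : psum (jw sn) 3 p x = p * x + 2 * (p * p * p * (x * x))).
  { cbn [psum]. unfold mono, wt. change (tri 0) with 0%nat. change (tri 1) with 1%nat.
    change (tri 2) with 3%nat. simpl. ring. }
  assert (E3 : mono p x 3 = (p * p * p * x) * (p * x) * (p * p * x)).
  { unfold mono. change (tri 3) with 6%nat. ring. }
  assert (Hc2 : p * p * x <= 1/10).
  { destruct Hs as [Hs|[Hs1 Hs2]]; [nra|].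
    assert (p * p <= 1/10 * (1/10)) by (apply Rmult_le_compat; lra). nra. }
  assert (Hpx : 0 < p * x) by nra.
  assert (0 <= p * p * x) by nra. assert (0 <= p * p * p * x) by nra.
  assert (mono p x 3 <= 1/10 * (p * x) * (1/10)).
  { rewrite E3. apply Rmult_le_compat; try nra. }
  assert (0 <= p * p * p * (x * x)) by (apply Rmult_le_pos; nra).
  replace (INR 3) with 3 in H by (simpl; ring).
  apply Rabs_le_between in H. lra.
Qed.

Lemma sm_pos_left (p x : R) : 3/4 <= p < 1 -> 0 <= x <= 31/10 -> 1/200 <= U sm p x.
Proof.
  intros Hp Hx.
  destruct (Rle_lt_dec x (1/10)) as [H1|H1].
  { assert (H := sm_small_x p x ltac:(lra) ltac:(lra)). lra. }
  apply (U_min_principle sm (3/4) p (1/10) (31/10)); try lra.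
  - apply tame_sm.
  - intros y Hy. apply row_sm_75. lra.
  - intros q Hq. split.
    + assert (H := sm_small_x q (1/10) ltac:(lra) ltac:(lra)). lra.
    + destruct (Rle_lt_dec q (181/200)); [apply num_sm_31 | apply asym_sm_31]; lra.
Qed.

Lemma sm_pos_right (p x : R) : 0 < p <= 3/4 -> 0 <= x <= 12/5 -> 1/100 <= U sm p x.
Proof.
  intros Hp Hx.
  destruct (Rle_lt_dec x (1/10)) as [H1|H1].
  { assert (H := sm_small_x p x ltac:(lra) ltac:(lra)). lra. }
  destruct (Rle_lt_dec p (1/10)) as [H2|H2].
  { assert (H := sm_small_p p x ltac:(lra) ltac:(lra)). lra. }
  apply (U_min_principle sm (1/10) p (1/10) (12/5)); try lra.
  - apply tame_sm.
  - intros y Hy. assert (H := sm_small_p (1/10) y ltac:(lra) ltac:(lra)). lra.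
  - intros q Hq. split.
    + assert (H := sm_small_x q (1/10) ltac:(lra) ltac:(lra)). lra.
    + apply num_sm_24. lra.
Qed.

(** The left side is placed at an arbitrarily small [a], chosen by the caller not to exceed the
    smaller zero; the bound [d] may depend on it. *)
Lemma jsn_pos (p r a : R) : 0 < p < 1 -> 0 < a <= 1/10 -> a <= r <= 12/5 ->
  (forall q, 1/10 <= q <= p -> 1/100 <= U (jw sn) q r) ->
  exists d, 0 < d /\ forall x, a <= x <= r -> d <= U (jw sn) p x.
Proof.
  intros Hp Ha Hr Hlat.
  destruct (Rle_lt_dec p (1/10)) as [H1|H1].
  - exists (p * a / 2). split; [nra|]. intros x Hx.
    apply Rle_trans with (p * x / 2); [nra|]. apply jsn_small; lra.
  - exists (a / 20). split; [lra|]. intros x Hx.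
    apply (U_min_principle (jw sn) (1/10) p a r); try lra.
    + apply tame_jw_sn.
    + intros y Hy. apply Rle_trans with (1/10 * y / 2); [lra|]. apply jsn_small; lra.
    + intros q Hq. split.
      * apply Rle_trans with (q * a / 2); [nra|]. apply jsn_small; lra.
      * specialize (Hlat q Hq). lra.
Qed.

Lemma sn_injective (p r x y : R) : 0 < p < 1 -> r <= 12/5 ->
  (forall q, 1/10 <= q <= p -> 1/100 <= U (jw sn) q r) ->
  0 < x < y -> y <= r -> U sp p x = 0 -> U sp p y = 0 -> False.
Proof.
  intros Hp Hr Hlat Hxy Hy H1 H2.
  assert (Ha : 0 < Rmin x (1/10)) by (apply Rmin_pos; lra).
  assert (Hax := Rmin_l x (1/10)). assert (Ha1 := Rmin_r x (1/10)).
  destruct (jsn_pos p r (Rmin x (1/10)) Hp ltac:(lra) ltac:(lra) Hlat) as (d & Hd & Hdx).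
  assert (H := U_increasing sn p x y d tame_sn tame_jw_sn ltac:(lra) Hxy Hd
    ltac:(intros; apply Hdx; lra)).
  rewrite !U_sn in H. lra.
Qed.

Lemma jsn_15 (q : R) : 1/10 <= q < 1 -> 1/100 <= U (jw sn) q (3/2).
Proof.
  intros Hq. destruct (Rle_lt_dec q (181/200)); [apply num_jsn_15 | apply asym_jsn_15]; lra.
Qed.

Lemma sn_15 (q : R) : 3/5 <= q < 1 -> 1/100 <= U sn q (3/2).
Proof.
  intros Hq. destruct (Rle_lt_dec q (181/200)); [apply num_sn_15 | apply asym_sn_15]; lra.
Qed.

Lemma sn_32 (q : R) : 39/50 <= q < 1 -> 151/10000 <= U sn q (16/5).
Proof.
  intros Hq. destruct (Rle_lt_dec q (4/5)); [apply num_sn_32a; lra|].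
  destruct (Rle_lt_dec q (181/200)); [apply num_sn_32b | apply asym_sn_32]; lra.
Qed.

Lemma sn_pos_80 (p x : R) : 4/5 <= p < 1 -> 3/2 <= x <= 16/5 -> 1/100 <= U sn p x.
Proof.
  intros Hp Hx. apply (U_min_principle sn (4/5) p (3/2) (16/5)); try lra.
  - apply tame_sn.
  - intros y Hy. apply row_sn_80. lra.
  - intros q Hq. split; [apply sn_15; lra|]. assert (H := sn_32 q ltac:(lra)). lra.
Qed.

Lemma sn_pos_60 (p x : R) : 3/5 <= p <= 4/5 -> 3/2 <= x <= 12/5 -> 1/100 <= U sn p x.
Proof.
  intros Hp Hx. apply (U_min_principle sn (3/5) p (3/2) (12/5)); try lra.
  - apply tame_sn.
  - intros y Hy. apply row_sn_60. lra.
  - intros q Hq. split; [apply sn_15 | apply num_sn_24]; lra.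
Qed.

(** The cut [3/2] lies beyond the smallest zero, where theta is already negative, yet safely below
    [1 + sqrt 2], where the limit [(1 - x) / (1 + x^2)] stops decreasing. *)
Lemma zero_unique_80 (p x y : R) : 4/5 <= p < 1 -> 0 < x < y -> y <= 16/5 ->
  U sp p x = 0 -> U sp p y = 0 -> False.
Proof.
  intros Hp Hxy Hy H1 H2.
  destruct (Rle_lt_dec (3/2) y) as [H3|H3].
  - assert (H := sn_pos_80 p y Hp ltac:(lra)). rewrite U_sn in H. lra.
  - apply (sn_injective p (3/2) x y); try lra. intros. apply jsn_15. lra.
Qed.

(** For small [p] theta is still positive at [3/2], being close to [1 - p x], so the sign argument
    fails; but for [p <= 3/5] the decrease persists up to [12/5]. *)
Lemma zero_unique (p x y : R) : 0 < p < 1 -> 0 < x < y -> y <= 12/5 ->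
  U sp p x = 0 -> U sp p y = 0 -> False.
Proof.
  intros Hp Hxy Hy H1 H2.
  destruct (Rle_lt_dec (4/5) p) as [H3|H3].
  { apply (zero_unique_80 p x y); lra. }
  destruct (Rle_lt_dec (3/5) p) as [H4|H4].
  - destruct (Rle_lt_dec (3/2) y) as [H5|H5].
    + assert (H := sn_pos_60 p y ltac:(lra) ltac:(lra)). rewrite U_sn in H. lra.
    + apply (sn_injective p (3/2) x y); try lra. intros. apply jsn_15. lra.
  - apply (sn_injective p (12/5) x y); try lra. intros. apply num_jsn_24. lra.
Qed.

(** * Existence of zeros, the value [q = -1], and the final statement *)

Lemma theta_continuity (p : R) : 0 < p < 1 -> continuity (theta (- p)).
Proof.
  intros Hp x.
  assert (Hlim : is_lim_seq (fun n => Rabs ((- p) ^ tri (S n) / (- p) ^ tri n)) 0).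
  { apply (is_lim_seq_ext (fun n => p ^ S n)).
    - intros n. rewrite tri_S, pow_add.
      replace ((- p) ^ tri n * (- p) ^ S n / (- p) ^ tri n) with ((- p) ^ S n)
        by (field; apply pow_nonzero; lra).
      rewrite <- RPow_abs, Rabs_Ropp, Rabs_pos_eq by lra. reflexivity.
    - apply (is_lim_seq_incr_1 (fun n => p ^ n)). apply is_lim_seq_geom.
      rewrite Rabs_pos_eq; lra. }
  assert (Hcv : CV_radius (fun n => (- p) ^ tri n) = p_infty).
  { apply CV_radius_infinite_DAlembert; [|exact Hlim].
    intros n. apply pow_nonzero. lra. }
  apply (continuity_pt_ext (PSeries (fun n => (- p) ^ tri n))).
  - intros y. unfold theta. destruct (Req_EM_T (- p) (-1)) as [E|_]; [lra|]. reflexivity.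
  - apply PSeries_continuity. rewrite Hcv. exact I.
Qed.

Lemma theta_IVT (p a b : R) : 0 < p < 1 -> a < b -> theta (- p) a * theta (- p) b <= 0 ->
  exists z, a <= z <= b /\ theta (- p) z = 0.
Proof.
  intros Hp Hab H.
  destruct (IVT_cor (theta (- p)) a b (theta_continuity p Hp) ltac:(lra) H) as [z Hz].
  now exists z.
Qed.

Lemma theta_0 (p : R) : 0 < p < 1 -> theta (- p) 0 = 1.
Proof.
  intros Hp. rewrite theta_pos by lra.
  assert (H : is_lim_seq (fun n => psum sp (S n) p 0) 1).
  { apply (is_lim_seq_ext (fun _ => 1)); [|apply is_lim_seq_const].
    intros n. induction n as [|n IH].
    - cbn [psum]. rewrite wt_sp. unfold mono. change (tri 0) with 0%nat. simpl. ring.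
    - change (psum sp (S (S n)) p 0) with (psum sp (S n) p 0 + wt sp (S n) * mono p 0 (S n)).
      rewrite <- IH. unfold mono. simpl. ring. }
  assert (H' := U_lim sp p 0 tame_sp ltac:(lra) ltac:(lra)).
  apply is_lim_seq_incr_1 in H'. apply is_lim_seq_unique in H. apply is_lim_seq_unique in H'.
  rewrite H in H'. now injection H'.
Qed.

Lemma theta_m1 (x : R) : theta (-1) x = (1 - x) / (1 + x ^ 2).
Proof. unfold theta. destruct (Req_EM_T (-1) (-1)); [reflexivity | tauto]. Qed.

(** The rectangle is closed, so its boundary lies in it and a bound on the whole rectangle
    suffices. *)
Lemma not_locally_Qminus (q x : R) : ~ locally (q, x) (fun z => ~ Qminus z) -> Qminus (q, x).
Proof.
  intros H. apply NNPP. intros HQ. apply H.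
  assert (Hd : exists e : posreal, forall u v, Rabs (u - q) < e -> Rabs (v - x) < e ->
    ~ Qminus (u, v)).
  { unfold Qminus in *. simpl in *.
    assert (Hcase : q < -1 \/ -0.75 < q \/ x < -3.1 \/ 0 < x) by lra.
    assert (Hex : forall d, 0 < d -> (forall u v, Rabs (u - q) < d -> Rabs (v - x) < d ->
      ~ (-1 <= u <= -0.75 /\ -3.1 <= v <= 0)) -> exists e : posreal, forall u v,
      Rabs (u - q) < e -> Rabs (v - x) < e -> ~ (-1 <= u <= -0.75 /\ -3.1 <= v <= 0)).
    { intros d Hd Hd'. exists (mkposreal d Hd). exact Hd'. }
    destruct Hcase as [C|[C|[C|C]]];
      [apply (Hex (-1 - q)) | apply (Hex (q + 0.75)) | apply (Hex (-3.1 - x)) | apply (Hex x)];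
      try lra; intros u v Hu Hv; apply Rabs_lt_between in Hu; apply Rabs_lt_between in Hv; lra. }
  destruct Hd as [e He]. exists e. intros [u v] [Hu Hv]. apply He; assumption.
Qed.

Lemma theta_Qminus (q x : R) : Qminus (q, x) -> 0.0049 < theta q x.
Proof.
  intros [Hq Hx]. simpl in Hq, Hx.
  destruct (Req_dec q (-1)) as [->|Hne].
  - rewrite theta_m1. assert (x ^ 2 <= 10) by (simpl; nra).
    assert (0 <= x ^ 2) by (simpl; nra).
    apply (Rmult_lt_reg_r (1 + x ^ 2)); [lra|].
    replace ((1 - x) / (1 + x ^ 2) * (1 + x ^ 2)) with (1 - x) by (field; lra). lra.
  - replace q with (- (- q)) by ring. replace x with (- (- x)) by ring.
    rewrite theta_neg by lra.
    assert (H := sm_pos_left (- q) (- x) ltac:(lra) ltac:(lra)). lra.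
Qed.

Lemma unique_smallest_zero (q : R) : -1 <= q <= -0.8 ->
  exists x0 : R, is_smallest_positive_zero (theta q) x0 /\ Qplus (q, x0) /\
    forall x : R, Qplus (q, x) -> theta q x = 0 -> x = x0.
Proof.
  intros Hq. unfold Qplus, is_smallest_positive_zero. simpl fst. simpl snd.
  destruct (Req_dec q (-1)) as [->|Hne].
  - assert (Hz : forall x, theta (-1) x = 0 -> x = 1).
    { intros x. rewrite theta_m1. intros H.
      assert (0 <= x ^ 2) by (simpl; nra).
      assert (1 - x = 0); [|lra].
      replace (1 - x) with ((1 - x) / (1 + x ^ 2) * (1 + x ^ 2)) by (field; lra).
      rewrite H. ring. }
    exists 1. repeat split; try lra.
    + rewrite theta_m1. field.
    + intros y _ Hy. rewrite (Hz y Hy). lra.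
    + intros x _ Hx. now apply Hz.
  - assert (Hp : 4/5 <= - q < 1) by lra. set (p := - q) in *.
    replace q with (- p) by (unfold p; ring).
    assert (H0 := theta_0 p ltac:(lra)).
    assert (H1 := sn_32 p ltac:(lra)). rewrite U_sn, <- theta_pos in H1 by lra.
    destruct (theta_IVT p 0 (16/5) ltac:(lra) ltac:(lra) ltac:(rewrite H0; lra)) as (z & Hz & Hz0).
    assert (Hzpos : 0 < z).
    { destruct (Req_dec z 0) as [E|]; [rewrite E in Hz0; lra | lra]. }
    assert (Huniq : forall y, 0 < y <= 16/5 -> theta (- p) y = 0 -> y = z).
    { intros y Hy Hy0. rewrite theta_pos in Hy0, Hz0 by lra.
      destruct (Rtotal_order y z) as [L|[E|L]]; [exfalso|exact E|exfalso].
      - apply (zero_unique_80 p y z); lra.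
      - apply (zero_unique_80 p z y); lra. }
    exists z. repeat split; try lra.
    + intros y Hy Hy0. destruct (Rle_lt_dec y (16/5)); [|lra].
      rewrite (Huniq y) by lra. lra.
    + intros x [_ Hx] Hx0. apply Huniq; [|exact Hx0].
      destruct (Req_dec x 0) as [E|]; [rewrite E in Hx0; lra | lra].
Qed.

Lemma three_zeros :
  exists x1 x2 x3 : R, three_smallest_positive_zeros (theta (-0.78)) x1 x2 x3 /\
    x1 < 3.2 /\ x2 < 3.2 /\ x3 < 3.2.
Proof.
  replace (-0.78) with (- (39/50)) by lra.
  set (f := theta (- (39/50))).
  assert (Hp : 0 < 39/50 < 1) by lra.
  assert (HU : forall x, 0 <= x -> f x = U sp (39/50) x) by (intros; apply theta_pos; lra).
  assert (HN : forall x, 0 <= x -> f x = - U sn (39/50) x)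
    by (intros x Hx; rewrite U_sn, HU by exact Hx; ring).
  assert (Ha : forall x y, 0 < x < y -> y <= 8/5 -> f y < f x).
  { intros x y Hxy Hy.
    assert (Hm : 0 < Rmin x (1/10)) by (apply Rmin_pos; lra).
    assert (Hm1 := Rmin_l x (1/10)). assert (Hm2 := Rmin_r x (1/10)).
    set (d := Rmin (1/1000) (39/50 * Rmin x (1/10) / 2)).
    assert (Hd : 0 < d) by (apply Rmin_pos; lra).
    assert (Hd1 : d <= 1/1000) by apply Rmin_l.
    assert (Hd2 : d <= 39/50 * Rmin x (1/10) / 2) by apply Rmin_r.
    assert (H := U_increasing sn (39/50) x y d tame_sn tame_jw_sn ltac:(lra) Hxy Hd).
    rewrite !HN by lra. apply Ropp_lt_contravar, H. intros c Hc.
    destruct (Rle_lt_dec c (1/10)) as [L|L].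
    - assert (H' := jsn_small (39/50) c Hp ltac:(lra) ltac:(lra)). lra.
    - assert (H' := row_78a c ltac:(lra)). lra. }
  assert (Hb : forall x, 8/5 <= x <= 2 -> f x < 0).
  { intros x Hx. assert (H := row_78b x Hx). rewrite HN; lra. }
  assert (Hc : forall x y, 2 <= x < y -> y <= 57/20 -> f x < f y).
  { intros x y Hxy Hy. rewrite !HU by lra.
    apply (U_increasing sp (39/50) x y (1/1000) tame_sp tame_jw_sp); try lra.
    intros c Hc. apply row_78c. lra. }
  assert (Hd : forall x, 57/20 <= x <= 61/20 -> 0 < f x).
  { intros x Hx. assert (H := row_78d x Hx). rewrite HU; lra. }
  assert (He : forall x y, 61/20 <= x < y -> y <= 16/5 -> f y < f x).
  { intros x y Hxy Hy. rewrite !HN by lra. apply Ropp_lt_contravar.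
    apply (U_increasing sn (39/50) x y (1/1000) tame_sn tame_jw_sn); try lra.
    intros c Hc'. apply row_78e. lra. }
  assert (H0 : f 0 = 1) by (apply theta_0; exact Hp).
  assert (H32 : f (16/5) < 0).
  { assert (H := sn_32 (39/50) ltac:(lra)). rewrite HN; lra. }
  assert (B1 := Hb (8/5) ltac:(lra)). assert (B2 := Hb 2 ltac:(lra)).
  assert (D1 := Hd (57/20) ltac:(lra)). assert (D2 := Hd (61/20) ltac:(lra)).
  destruct (theta_IVT (39/50) 0 (8/5) Hp ltac:(lra) ltac:(fold f; nra)) as (x1 & Hx1 & Z1).
  destruct (theta_IVT (39/50) 2 (57/20) Hp ltac:(lra) ltac:(fold f; nra)) as (x2 & Hx2 & Z2).
  destruct (theta_IVT (39/50) (61/20) (16/5) Hp ltac:(lra) ltac:(fold f; nra)) as (x3 & Hx3 & Z3).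
  fold f in Z1, Z2, Z3.
  assert (x1 <> 0) by (intros E; rewrite E in Z1; lra).
  assert (x3 <> 16/5) by (intros E; rewrite E in Z3; lra).
  exists x1, x2, x3. unfold three_smallest_positive_zeros.
  split; [|lra].
  refine (conj _ (conj _ (conj Z1 (conj Z2 (conj Z3 _))))); try lra.
  intros y Hy Zy.
  destruct (Rle_lt_dec y (8/5)) as [L1|L1].
  { left. destruct (Rtotal_order y x1) as [T|[T|T]]; [exfalso|exact T|exfalso].
    - assert (H' := Ha y x1 ltac:(lra) ltac:(lra)). lra.
    - assert (H' := Ha x1 y ltac:(lra) ltac:(lra)). lra. }
  destruct (Rle_lt_dec y 2) as [L2|L2].
  { assert (H' := Hb y ltac:(lra)). lra. }
  destruct (Rle_lt_dec y (57/20)) as [L3|L3].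
  { right; left. destruct (Rtotal_order y x2) as [T|[T|T]]; [exfalso|exact T|exfalso].
    - assert (H' := Hc y x2 ltac:(lra) ltac:(lra)). lra.
    - assert (H' := Hc x2 y ltac:(lra) ltac:(lra)). lra. }
  destruct (Rle_lt_dec y (61/20)) as [L4|L4].
  { assert (H' := Hd y ltac:(lra)). lra. }
  right; right. destruct (Rtotal_order y x3) as [T|[T|T]]; [exfalso|exact T|exfalso].
  - assert (H' := He y x3 ltac:(lra) ltac:(lra)). lra.
  - assert (H' := He x3 y ltac:(lra) ltac:(lra)). lra.
Qed.

Theorem proposition3 :
  (forall q x : R, -1 < q < 0 -> x < 0 -> theta q x = 0 -> x < -2.4) /\
  (forall q x : R, -1 < q < 0 -> 0 < x -> theta q x = 0 ->
     ~ is_smallest_positive_zero (theta q) x -> 2.4 < x) /\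
  ((forall q x : R, Qminus (q, x) -> x < 0 -> theta q x <> 0) /\
   (forall q : R, -1 <= q <= -0.8 ->
      exists x0 : R,
        is_smallest_positive_zero (theta q) x0 /\ Qplus (q, x0) /\
        forall x : R, Qplus (q, x) -> theta q x = 0 -> x = x0) /\
   (forall q x : R, boundary Qminus (q, x) -> 0.0049 < theta q x) /\
   (forall q : R, -1 <= q <= -0.78 -> theta q 3.2 < -0.015) /\
   (exists x1 x2 x3 : R,
      three_smallest_positive_zeros (theta (-0.78)) x1 x2 x3 /\
      x1 < 3.2 /\ x2 < 3.2 /\ x3 < 3.2)).
Proof.
  refine (conj _ (conj _ (conj _ (conj unique_smallest_zero (conj _ (conj _ three_zeros)))))).
  - intros q x Hq Hx H0. apply Rnot_le_lt. intros Hle.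
    replace q with (- (- q)) in H0 by ring. replace x with (- (- x)) in H0 by ring.
    rewrite theta_neg in H0 by lra.
    destruct (Rle_lt_dec (3/4) (- q)).
    + assert (H := sm_pos_left (- q) (- x) ltac:(lra) ltac:(lra)). lra.
    + assert (H := sm_pos_right (- q) (- x) ltac:(lra) ltac:(lra)). lra.
  (* By contraposition: a zero in [(0, 2.4]] has no smaller positive zero by [zero_unique], so it is
     the smallest one. *)
  - intros q x Hq Hx H0 Hns. apply Rnot_le_lt. intros Hle. apply Hns.
    split; [exact Hx | split; [exact H0|]]. intros y Hy Hy0.
    apply Rnot_lt_le. intros Hlt.
    replace q with (- (- q)) in H0, Hy0 by ring.
    rewrite theta_pos in H0, Hy0 by lra.
    apply (zero_unique (- q) y x); lra.
  - intros q x HQ _ H0. assert (H := theta_Qminus q x HQ). lra.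
  - intros q x [Hb _]. now apply theta_Qminus, not_locally_Qminus.
  - intros q Hq. destruct (Req_dec q (-1)) as [->|Hne].
    + rewrite theta_m1. simpl. lra.
    + replace q with (- (- q)) by ring. rewrite theta_pos by lra.
      replace 3.2 with (16/5) by lra.
      assert (H := sn_32 (- q) ltac:(lra)). rewrite U_sn in H. lra.
Qed.
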